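(* Let $n\ge 2$ and $d$ be integers. Then $G(\alpha;n,d,n-1)$ is non-empty for some $\alpha\in\mathbb{R}$ if and only if $d\ge n$. Moreover, if $d\ge n$, then the upper bound for $\alpha$ is precisely $d$, i.e. $\sup\{\alpha\in\mathbb{R} : G(\alpha;n,d,n-1)\neq\emptyset\}=d$.
   Context: Work on the projective line $\mathbb{P}^1$ over an algebraically closed field. A coherent system of type $(n,d,k)$ is a pair $(E,V)$ where $E$ is a vector bundle of rank $n$ and degree $d$ on $\mathbb{P}^1$ and $V\subset H^0(E)$ is a vector subspace of dimension $k$. For $\alpha\in\mathbb{R}$ its $\alpha$-slope is $\mu_\alpha(E,V)=\frac{d}{n}+\alpha\frac{k}{n}$. A coherent subsystem of $(E,V)$ is a coherent system $(E',V')$ with $E'$ a (nonzero) subbundle of $E$ and $V'\subset V\cap H^0(E')$; it is proper if $(E',V')\neq(E,V)$. $(E,V)$ is $\alpha$-stable if $\mu_\alpha(E',V')<\mu_\alpha(E,V)$ for every proper coherent subsystem $(E',V')$. $G(\alpha;n,d,k)$ denotes the moduli space of $\alpha$-stable coherent systems of type $(n,d,k)$ on $\mathbb{P}^1$. *)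

(* Defs.v *)
From HB Require Import structures.
From mathcomp Require Import all_boot all_order all_algebra.
From mathcomp Require Import all_classical all_reals.

Set Implicit Arguments.
Unset Strict Implicit.
Unset Printing Implicit Defensive.

Import Order.TTheory GRing.Theory Num.Theory.

Local Open Scope classical_set_scope.
Local Open Scope ring_scope.

(* P^1 over F is covered by two affine lines with coordinates t and 1/t, glued
   along Spec F[t, 1/t].  Everything below is expressed in these two charts;
   a vector bundle on an affine line is trivial (F[t] is a PID), so a rank n
   bundle on P^1 amounts to a transition matrix in GL_n(F[t, 1/t]). *)

Definition ratfun (F : fieldType) := {fraction {poly F}}.

Definition tvar (F : fieldType) : ratfun F := tofrac 'X.

(* p(t) *)
Definition chart0 (F : fieldType) (p : {poly F}) : ratfun F := tofrac p.

(* p(1/t) *)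
Definition chart1 (F : fieldType) (p : {poly F}) : ratfun F :=
  (map_poly (fun c : F => tofrac c%:P : ratfun F) p).[(tvar F)^-1].

Definition laurent (F : fieldType) (x : ratfun F) : Prop :=
  exists (p : {poly F}) (m : nat), x = tofrac p / tvar F ^+ m.

Record vbundle (F : fieldType) (n : nat) := VBundle {
  trans : 'M[ratfun F]_n;
  trans_laurent : forall i j, laurent (trans i j);
  trans_invertible : exists2 B : 'M[ratfun F]_n,
    (forall i j, laurent (B i j)) & trans *m B = 1%:M
}.

(* The transition function of det E is a unit of F[t, 1/t], that is c * t^d.
   With sections glued by s_0(t) = trans * s_1(1/t), the function t^d is the
   transition function of O(d). *)
Definition has_degree (F : fieldType) (n : nat) (E : vbundle F n) (d : int)
  : Prop :=
  exists2 c : F, c != 0 & \det (trans E) = tofrac c%:P * tvar F ^ d.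

(* Local sections on the two charts, the second one being written as a
   polynomial in the coordinate 1/t. *)
Definition local_sections (F : fieldType) (n : nat) : Type :=
  ('cV[{poly F}]_n * 'cV[{poly F}]_n)%type.

Definition H0 (F : fieldType) (n : nat) (E : vbundle F n)
  : set (local_sections F n) :=
  [set s | map_mx (@chart0 F) s.1 = trans E *m map_mx (@chart1 F) s.2].

Definition lin_comb (F : fieldType) (n k : nat) (c : 'I_k -> F)
    (b : 'I_k -> local_sections F n) : local_sections F n :=
  (\sum_(i < k) (c i)%:P *: (b i).1, \sum_(i < k) (c i)%:P *: (b i).2).

(* V is an F-linear subspace of dimension k: it has a basis with k elements. *)
Definition subspace_of_dim (F : fieldType) (n k : nat)
    (V : set (local_sections F n)) : Prop :=
  exists b : 'I_k -> local_sections F n,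
    (forall c : 'I_k -> F, lin_comb c b = (0, 0) -> forall i, c i = 0) /\
    V = [set s | exists c : 'I_k -> F, s = lin_comb c b].

Record bundle_hom (F : fieldType) (m n : nat)
    (E : vbundle F m) (E' : vbundle F n) := BundleHom {
  hom0 : 'M[{poly F}]_(n, m);
  hom1 : 'M[{poly F}]_(n, m);
  hom_compat : map_mx (@chart0 F) hom0 *m trans E =
               trans E' *m map_mx (@chart1 F) hom1
}.

Definition hom_sections (F : fieldType) (m n : nat)
    (E : vbundle F m) (E' : vbundle F n) (f : bundle_hom E E')
    (s : local_sections F m) : local_sections F n :=
  (hom0 f *m s.1, hom1 f *m s.2).

Definition bundle_iso (F : fieldType) (m n : nat)
    (E : vbundle F m) (E' : vbundle F n) (f : bundle_hom E E') : Prop :=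
  exists g : bundle_hom E' E,
    [/\ hom0 f *m hom0 g = 1%:M, hom0 g *m hom0 f = 1%:M,
        hom1 f *m hom1 g = 1%:M & hom1 g *m hom1 f = 1%:M].

(* f embeds E as a subbundle of E': it is injective on the fibre at every
   (closed) point of each chart. *)
Definition subbundle (F : fieldType) (m n : nat)
    (E : vbundle F m) (E' : vbundle F n) (f : bundle_hom E E') : Prop :=
  forall (x : F),
    \rank (map_mx (fun p : {poly F} => p.[x]) (hom0 f)) = m /\
    \rank (map_mx (fun p : {poly F} => p.[x]) (hom1 f)) = m.

Record coherent_system (F : fieldType) (n : nat) (d : int) (k : nat) :=
  CoherentSystem {
  cs_bundle : vbundle F n;
  cs_degree : has_degree cs_bundle d;
  cs_space : set (local_sections F n);
  cs_space_sub : cs_space `<=` H0 cs_bundle;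
  cs_space_dim : subspace_of_dim k cs_space
}.

Definition mu (R : realType) (alpha : R) (n : nat) (d : int) (k : nat) : R :=
  d%:~R / n%:R + alpha * (k%:R / n%:R).

Definition coherent_subsystem (F : fieldType)
    (n' : nat) (d' : int) (k' : nat) (S' : coherent_system F n' d' k')
    (n : nat) (d : int) (k : nat) (S : coherent_system F n d k)
    (f : bundle_hom (cs_bundle S') (cs_bundle S)) : Prop :=
  [/\ (0 < n')%N, subbundle f & hom_sections f @` cs_space S' `<=` cs_space S].

(* f identifies S' with S, i.e. (E', V') = (E, V). *)
Definition whole_system (F : fieldType)
    (n' : nat) (d' : int) (k' : nat) (S' : coherent_system F n' d' k')
    (n : nat) (d : int) (k : nat) (S : coherent_system F n d k)
    (f : bundle_hom (cs_bundle S') (cs_bundle S)) : Prop :=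
  bundle_iso f /\ hom_sections f @` cs_space S' = cs_space S.

Definition alpha_stable (F : fieldType) (R : realType) (alpha : R)
    (n : nat) (d : int) (k : nat) (S : coherent_system F n d k) : Prop :=
  forall (n' : nat) (d' : int) (k' : nat) (S' : coherent_system F n' d' k')
    (f : bundle_hom (cs_bundle S') (cs_bundle S)),
    coherent_subsystem f -> ~ whole_system f ->
    mu alpha n' d' k' < mu alpha n d k.

Definition cs_isomorphic (F : fieldType) (n : nat) (d : int) (k : nat)
    (S S' : coherent_system F n d k) : Prop :=
  exists f : bundle_hom (cs_bundle S) (cs_bundle S'), whole_system f.

(* The (closed) points of the moduli space G(alpha; n, d, k): isomorphism
   classes of alpha-stable coherent systems of type (n, d, k). *)
Definition G (F : fieldType) (R : realType) (alpha : R)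
    (n : nat) (d : int) (k : nat) : set (set (coherent_system F n d k)) :=
  [set C | exists2 S : coherent_system F n d k,
     alpha_stable alpha S & C = [set S' | cs_isomorphic S S']].
Arguments G F {R} alpha n d k.

(* Main.v *)
Require Import Defs.
From HB Require Import structures.
From mathcomp Require Import all_boot all_order all_algebra.
From mathcomp Require Import all_classical all_reals.
From mathcomp Require Import perm zify ring lra.

(** Let (E, V) be of type (n, d, n - 1).

    Necessity.  If (E, V) is alpha-stable then alpha > 0, as is seen by shrinking
    V to 0 ([stable_alpha_gt0]).  A nonzero map E -> O(e) has a saturated kernel
    of rank n - 1 and degree at least d - e ([kernel_subbundle]), and stability
    bounds the slope of that kernel together with the sections it contains
    ([stable_line_map]).  Such maps are supplied by a dimension count: E is a sum
    of line bundles ([splitting]), so there are at least n e - d + n independent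
    maps E -> O(e) ([riemann_roch]), while killing one section of E costs
    h^0(O(e)) linear conditions ([line_map_killing]).  Three values of e matter.
    - If d >= 0, take e = d: killing V costs (n - 1)(d + 1) conditions, one less
      than the number n d - d + n of available maps.  The kernel contains V, and
      its slope inequality reads alpha < d.
    - If d < 0, take e to be the integral part of d / n.  As e < 0, every section
      is killed, and the kernel has d' / (n - 1) >= d / n with all the sections:
      this contradicts stability.
    - If 0 <= d < n, take e = 0.  A map to O kills a hyperplane of V, and the
      slope inequality reads d < alpha, against the first case.
    So d >= n and alpha < d ([stable_bounds]).

    Sufficiency.  The group H^1(O(-d)) has the basis t, ..., t^(d-1), so for
    d >= n there is an extension of O(d) by the trivial bundle of rank n - 1
    whose n - 1 components are independent.  Take for V the constant sections of
    the trivial subbundle ([ext_system]).  A subsystem (E', V') of type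
    (n', d', k') falls into one of two classes.
    - If E' lies in the trivial subbundle then d' <= 0 and k' <= n'.
    - Otherwise the kernel of E' -> O(d) lies in the trivial subbundle, which
      gives d' <= d and k' <= n' - 1.
    Each such triple satisfies the stability inequality when d - 1 <= alpha < d,
    except d' = d, k' = n' - 1.  In that case V' trivialises the kernel of
    E' -> O(d) and this map is onto, so the extension splits modulo the constant
    subbundle spanned by V'; independence of the components then forces V' = V
    and E' = E ([extremal_subsystem], [extremal_whole]).  Hence the
    system is stable on the whole interval [d - 1, d) ([ext_stable]), whose
    supremum is d. *)

Set Implicit Arguments.
Unset Strict Implicit.
Unset Printing Implicit Defensive.

Import Order.TTheory GRing.Theory Num.Theory.

Local Open Scope classical_set_scope.
Local Open Scope ring_scope.

(** * Gluing the two charts *)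

Section Charts.
Variable F : fieldType.
Implicit Types (p q g : {poly F}) (x y : ratfun F) (a b : int).

Local Notation t := (tvar F).

Lemma tvar_neq0 : t != 0.
Proof. by rewrite tofrac_eq0 polyX_eq0. Qed.

Lemma chart1E p :
  chart1 p = (map_poly (@tofrac {poly F} \o @polyC F) p).[t^-1].
Proof. by []. Qed.

Lemma chart1_is_zmod_morphism : zmod_morphism (@chart1 F).
Proof. by move=> p q; rewrite !chart1E rmorphB hornerD hornerN. Qed.

Lemma chart1_is_monoid_morphism : monoid_morphism (@chart1 F).
Proof.
by split=> [|p q]; rewrite !chart1E ?rmorph1 ?hornerC // rmorphM hornerM.
Qed.

HB.instance Definition _ := GRing.isZmodMorphism.Build {poly F} (ratfun F)
  (@chart1 F) chart1_is_zmod_morphism.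
HB.instance Definition _ := GRing.isMonoidMorphism.Build {poly F} (ratfun F)
  (@chart1 F) chart1_is_monoid_morphism.

HB.instance Definition _ := GRing.isZmodMorphism.Build {poly F} (ratfun F)
  (@chart0 F) (@tofrac_is_zmod_morphism _).
HB.instance Definition _ := GRing.isMonoidMorphism.Build {poly F} (ratfun F)
  (@chart0 F) (@tofrac_is_monoid_morphism _).

Lemma chart0C (c : F) : chart0 c%:P = tofrac c%:P. Proof. by []. Qed.

Lemma chart1C (c : F) : chart1 c%:P = tofrac c%:P.
Proof. by rewrite chart1E map_polyC hornerC. Qed.

Lemma chart0X : chart0 'X = t. Proof. by []. Qed.

Lemma chart1X : chart1 'X = t^-1.
Proof. by rewrite chart1E map_polyX hornerX. Qed.

(** The coefficients of t ^ N p(1/t). *)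
Definition reverse_poly (N : nat) p : {poly F} := \poly_(i < N.+1) p`_(N - i).

Lemma chart1_reverse (N : nat) p : (size p <= N.+1)%N ->
  chart1 p * t ^+ N = chart0 (reverse_poly N p).
Proof.
move=> szp; rewrite /chart1 (horner_coef_wide (n := N.+1)); last first.
  exact: leq_trans (size_poly _ _) szp.
rewrite /reverse_poly poly_def rmorph_sum mulr_suml (reindex_inj rev_ord_inj) /=.
apply: eq_bigr => i _; rewrite subSS coef_map_id0 ?rmorph0 //=.
have iN : (i <= N)%N by rewrite -ltnS.
rewrite -mul_polyC rmorphM rmorphXn /= chart0X -mulrA; congr (_ * _).
by rewrite -[in t ^+ N](subnK iN) exprD mulrA exprVn mulVf ?mul1r // expf_neq0 // tvar_neq0.
Qed.

Lemma chart0_inj : injective (@chart0 F).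
Proof. by move=> p q /eqP; rewrite tofrac_eq => /eqP. Qed.

Lemma chart0_eq0 p : (chart0 p == 0) = (p == 0).
Proof. exact: tofrac_eq0. Qed.

Lemma chart1_eq0 p : (chart1 p == 0) = (p == 0).
Proof.
apply/eqP/eqP => [p0|->]; last exact: rmorph0.
have [-> //|pn0] := eqVneq p 0.
have szp : (0 < size p)%N by rewrite size_poly_gt0.
have /eqP := chart1_reverse (N := (size p).-1) (p := p) ltac:(by rewrite prednK).
rewrite p0 mul0r eq_sym chart0_eq0 => /eqP/polyP/(_ 0%N).
rewrite coef_poly /= subn0 coef0 => /eqP.
by rewrite -/(lead_coef p) lead_coef_eq0 (negPf pn0).
Qed.

Lemma chart1_inj : injective (@chart1 F).
Proof.
by move=> p q /eqP; rewrite -subr_eq0 -rmorphB /= chart1_eq0 subr_eq0 => /eqP.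
Qed.

(** Comparison of the orders at infinity: [chart0 g0] has order
    1 - size g0 there, while [chart1 g1] is regular.  Multiplying by [t ^+ N]
    turns this into a comparison of degrees of polynomials.  This bound is the
    source of every degree estimate below. *)
Lemma gluing_degree0 g0 g1 a b : g0 != 0 ->
  chart0 g0 * t ^ a = chart1 g1 * t ^ b -> (size g0)%:Z + a <= 1 + b.
Proof.
move=> g0n0 eq_g; have tn0 := tvar_neq0.
rewrite leNgt; apply/negP => lt_ba.
have [k ak] : exists k : nat, a - b = k%:Z - (size g0)%:Z + 2.
  by exists (absz (a - b + (size g0)%:Z - 2)%R); lia.
pose N := size g1.
have := chart1_reverse (leqnSn N).
have -> : chart1 g1 = chart0 g0 * t ^ (a - b).
  by rewrite expfzDr // mulrA eq_g -mulrA -expfzDr // subrr mulr1.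
rewrite -[t ^+ N]/(t ^ N%:Z) -mulrA -expfzDr // => E.
have E' : chart0 (g0 * 'X^(k + N + 2)) = chart0 (reverse_poly N g1 * 'X^(size g0)).
  rewrite 2!rmorphM /= -E !rmorphXn /= chart0X -mulrA.
  rewrite -[t ^+ size g0]/(t ^ (size g0)%:Z) -expfzDr // ak -[t ^+ _]/(t ^ _%:Z).
  by congr (_ * t ^ _); lia.
move/chart0_inj: E' => /(congr1 (size : {poly F} -> nat)).
rewrite size_mulXn //.
have := size_polyMleq (reverse_poly N g1) 'X^(size g0).
have : (size (reverse_poly N g1) <= N.+1)%N by apply: size_poly.
rewrite size_polyXn; lia.
Qed.

(** The symmetric comparison, at the origin. *)
Lemma gluing_degree1 g0 g1 a b : g1 != 0 ->
  chart0 g0 * t ^ a = chart1 g1 * t ^ b -> (size g1)%:Z + a <= 1 + b.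
Proof.
move=> g1n0 eq_g; have tn0 := tvar_neq0.
rewrite leNgt; apply/negP => lt_ba.
have szg : (0 < size g1)%N by rewrite size_poly_gt0.
pose N := (size g1).-1.
have [k ak] : exists k : nat, a - b + N%:Z = k%:Z + 1.
  by exists (absz (a - b + N%:Z - 1)%R); rewrite /N; lia.
have := chart1_reverse (N := N) (p := g1) ltac:(by rewrite prednK).
have -> : chart1 g1 = chart0 g0 * t ^ (a - b).
  by rewrite expfzDr // mulrA eq_g -mulrA -expfzDr // subrr mulr1.
rewrite -[t ^+ N]/(t ^ N%:Z) -mulrA -expfzDr // ak => E.
have E' : chart0 (g0 * 'X^(k.+1)) = chart0 (reverse_poly N g1).
  by rewrite -E rmorphM rmorphXn /= chart0X -[t ^+ _]/(t ^ _%:Z); congr (_ * t ^ _); lia.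
move/chart0_inj: E' => /polyP/(_ 0%N).
rewrite coefMXn /= coef_poly /= subn0 => /esym/eqP.
by rewrite -/(lead_coef g1) lead_coef_eq0 (negPf g1n0).
Qed.

Lemma tvar_expz_inj (c c' : F) a b : c != 0 ->
  tofrac c%:P * t ^ a = tofrac c'%:P * t ^ b -> a = b.
Proof.
move=> c0 E.
have c'0 : c' != 0.
  apply: contra_neq c0 => c'0; move/eqP: E.
  by rewrite c'0 polyC0 tofrac0 mul0r mulf_eq0 tofrac_eq0 polyC_eq0 expfz_eq0
             (negPf tvar_neq0) andbF orbF => /eqP.
have := @gluing_degree0 c%:P c'%:P a b; rewrite polyC_eq0 chart1C => /(_ c0 E).
have := @gluing_degree0 c'%:P c%:P b a; rewrite polyC_eq0 chart1C => /(_ c'0 (esym E)).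
rewrite !size_polyC c0 c'0; lia.
Qed.

Lemma laurent_tvar (a : int) : laurent (t ^ a).
Proof.
case: a => m; first by exists 'X^m, 0%N; rewrite expr0 divr1 tofracXn.
by exists 1, m.+1; rewrite tofrac1 mul1r.
Qed.

Lemma laurent_chart0 p : laurent (chart0 p).
Proof. by exists p, 0%N; rewrite expr0 divr1. Qed.

Lemma laurent_chart1 p : laurent (chart1 p).
Proof.
exists (reverse_poly (size p) p), (size p).
by rewrite -/(chart0 _) -chart1_reverse // mulfK // expf_neq0 // tvar_neq0.
Qed.

Lemma laurent0 : laurent (0 : ratfun F).
Proof. by rewrite -(rmorph0 (@chart0 F)); apply: laurent_chart0. Qed.

Lemma laurent1 : laurent (1 : ratfun F).
Proof. by rewrite -(rmorph1 (@chart0 F)); apply: laurent_chart0. Qed.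

Lemma laurentD x y : laurent x -> laurent y -> laurent (x + y).
Proof.
move=> [p [m ->]] [q [k ->]]; exists (p * 'X^k + q * 'X^m), (m + k)%N.
rewrite tofracD !tofracM !tofracXn -/t exprD.
by rewrite addf_div ?expf_neq0 ?tvar_neq0.
Qed.

Lemma laurentM x y : laurent x -> laurent y -> laurent (x * y).
Proof.
move=> [p [m ->]] [q [k ->]]; exists (p * q), (m + k)%N.
by rewrite tofracM exprD mulf_div.
Qed.

Lemma laurent_sum (I : finType) (f : I -> ratfun F) :
  (forall i, laurent (f i)) -> laurent (\sum_i f i).
Proof.
by move=> lf; elim/big_ind: _ => //; [apply: laurent0 | apply: laurentD].
Qed.

Lemma laurent_prod (I : finType) (f : I -> ratfun F) :
  (forall i, laurent (f i)) -> laurent (\prod_i f i).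
Proof.
by move=> lf; elim/big_ind: _ => //; [apply: laurent1 | apply: laurentM].
Qed.

Lemma laurent_mulmx m n k (A : 'M[ratfun F]_(m, n)) (B : 'M_(n, k)) :
  (forall i j, laurent (A i j)) -> (forall i j, laurent (B i j)) ->
  forall i j, laurent ((A *m B) i j).
Proof.
by move=> lA lB i j; rewrite mxE; apply: laurent_sum => l; apply: laurentM.
Qed.

Lemma laurent_det n (A : 'M[ratfun F]_n) :
  (forall i j, laurent (A i j)) -> laurent (\det A).
Proof.
move=> lA; apply: laurent_sum => s; apply: laurentM; last exact: laurent_prod.
rewrite -(rmorph_sign (@chart0 F)); exact: laurent_chart0.
Qed.

(** The units of F[t, 1/t] are the monomials, because the divisors of a power
    of t are monomials. *)
Lemma laurent_unit x y : laurent x -> laurent y -> x * y = 1 ->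
  exists2 c : F, c != 0 & exists a : int, x = tofrac c%:P * t ^ a.
Proof.
move=> [p [m ->]] [q [k ->]] E.
have {}E : p * q = ('X - 0%:P) ^+ (m + k).
  apply/eqP; rewrite -tofrac_eq tofracM subr0 tofracXn -/t exprD.
  by move: E; rewrite mulf_div => /divr1_eq ->.
have : p %| ('X - 0%:P) ^+ (m + k) by rewrite -E dvdp_mulr.
case/dvdp_exp_XsubCP => j _; rewrite subr0 => /eqpf_eq [c c0 ->].
exists c => //; exists (j%:Z - m%:Z).
by rewrite -mul_polyC tofracM tofracXn expfzDr ?tvar_neq0 // mulrA exprnN.
Qed.

(** A Laurent polynomial has a pole of bounded order at infinity. *)
Lemma laurent_chart1_shift x : laurent x ->
  exists M : nat, forall N, (M <= N)%N -> exists q, x = t ^+ N * chart1 q.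
Proof.
move=> [p [m ->]]; exists (size p) => N szN.
exists ('X^m * reverse_poly N p).
have szp : (size (reverse_poly N p) <= N.+1)%N by apply: size_poly.
have E : p = reverse_poly N (reverse_poly N p).
  apply/polyP=> i; rewrite !coef_poly.
  case: ltnP => iN; last by rewrite nth_default // (leq_trans szN) // ltnW.
  by rewrite ltnS leq_subr subKn.
rewrite {1}E -/(chart0 _) -chart1_reverse // rmorphM rmorphXn /= chart1X exprVn.
by rewrite mulrAC mulrC; congr (_ * _); rewrite mulrC.
Qed.

End Charts.

(** * Splitting of bundles *)

Section Splitting.
Variable F : fieldType.

Local Notation t := (tvar F).
(* The transition matrix of the sum of the O(r i). *)
Local Notation twist r := (diag_mx (\row_i t ^ r i)).

Lemma unit_polyP (p : {poly F}) :
  p \is a GRing.unit -> exists2 c : F, c != 0 & p = c%:P.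
Proof.
rewrite poly_unitE => /andP[/size_poly1P[c c0 ->] _]; by exists c.
Qed.

Lemma prod_expz (I : finType) (r : I -> int) :
  \prod_i t ^ r i = t ^ (\sum_i r i).
Proof.
by elim/big_rec2: _ => // i y x _ ->; rewrite expfzDr // tvar_neq0.
Qed.

Lemma det_twist n (r : 'I_n -> int) : \det (twist r) = t ^ (\sum_i r i).
Proof. by rewrite det_diag -prod_expz; apply: eq_bigr => i _; rewrite mxE. Qed.

Lemma map_chartC m n (A : 'M[F]_(m, n)) :
  map_mx (@chart0 F) (map_mx polyC A) = map_mx (@chart1 F) (map_mx polyC A).
Proof. by apply/matrixP => i j; rewrite !mxE chart1C. Qed.

Lemma det_replace_row n (i : 'I_n) (v : 'rV[F]_n) : v 0 i != 0 ->
  \det (\matrix_(k, l) if k == i then v 0 l else (k == l)%:R) != 0.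
Proof.
move=> vi; apply/negP => /det0P [w wn0 /rowP w0].
have wE l : w 0 i * v 0 l + (if l == i then 0 else w 0 l) = 0.
  have := w0 l; rewrite !mxE (bigD1 i) //= !mxE eqxx => E.
  rewrite -[RHS]E; congr (_ + _).
  case: (eqVneq l i) => [->|li].
    by rewrite big1 // => k ki; rewrite !mxE (negPf ki) mulr0.
  rewrite (bigD1 l) //= !mxE (negPf li) eqxx mulr1 big1 ?addr0 // => k /andP[ki kl].
  by rewrite !mxE (negPf ki) (negPf kl) mulr0.
have wi : w 0 i = 0.
  by have := wE i; rewrite eqxx addr0 => /eqP; rewrite mulf_eq0 (negPf vi) orbF => /eqP.
case/eqP: wn0; apply/rowP => l; rewrite mxE; have := wE l; rewrite wi mul0r add0r.
by case: eqVneq => [->|].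
Qed.

(** When [N] is singular at the point at infinity, a combination of its rows is
    divisible by the coordinate there.  Using the row of largest twist among
    those involved, the combination is realised by polynomial row operations on
    the other chart, so that one twist drops by one, and with it the order [m] of
    the zero of the determinant. *)
Lemma row_reduction n (N : 'M[{poly F}]_n) (r : 'I_n -> int) (m : nat) (c : F) :
  c != 0 -> \det N = c *: 'X^m ->
  exists U N' (r' : 'I_n -> int), [/\ U \in unitmx, N' \in unitmx &
    twist r *m map_mx (@chart1 F) N =
    map_mx (@chart0 F) U *m twist r' *m map_mx (@chart1 F) N'].
Proof.
elim: m c N r => [|m IH] c N r c0 detN.
  exists 1%:M, N, r; split; rewrite ?unitmx1 ?map_mx1 ?mul1mx //.
  by rewrite unitmxE detN expr0 alg_polyC poly_unitE size_polyC coefC c0 unitfE c0.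
have /eqP/det0P [v vn0 vN] : \det (map_mx (horner_eval (0 : F)) N) = 0.
  by rewrite det_map_mx detN /= /horner_eval hornerZ hornerXn expr0n mulr0.
have [i0 vi0] : exists i, v 0 i != 0.
  by apply/existsP; rewrite -negb_forall; apply: contra vn0 => /forallP v0;
     apply/eqP/rowP => i; rewrite mxE; apply/eqP; apply: v0.
(* The row of largest twist among those that occur in the relation v. *)
have [i vi imax] : exists2 i, v 0 i != 0 & forall j, v 0 j != 0 -> r j <= r i.
  have [i vi im] := @Order.TotalTheory.arg_maxP _ _ _ i0 (fun i => v 0 i != 0) r vi0.
  by exists i.
pose D : 'M[F]_n := \matrix_(k, l) if k == i then v 0 l else (k == l)%:R.
have detD : \det D != 0 by apply: det_replace_row.
pose C : 'M[{poly F}]_n := \matrix_(k, l)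
  if k == i then v 0 l *: 'X^(absz (r i - r l)%R) else (k == l)%:R.
pose N' : 'M[{poly F}]_n := \matrix_(k, l)
  if k == i then (\sum_j v 0 j *: N j l) %/ 'X else N k l.
pose e : 'rV[{poly F}]_n := \row_k if k == i then 'X else 1.
pose r' k := if k == i then r i - 1 else r k.
have tn0 := tvar_neq0 F.
(* Conjugating D by the twists gives polynomial entries t ^ (r i - r l) because
   r i is the largest of the relevant twists. *)
have CD : map_mx (@chart0 F) C *m twist r =
          twist r *m map_mx (@chart0 F) (map_mx polyC D).
  apply/matrixP => k l; rewrite mul_mx_diag mul_diag_mx !mxE.
  case: eqP => [->|_].
    have [->|vl] := eqVneq (v 0 l) 0; first by rewrite scale0r polyC0 rmorph0 mul0r mulr0.
    rewrite -mul_polyC rmorphM rmorphXn /= chart0X mulrC [RHS]mulrC mulrCA; congr (_ * _).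
    rewrite -[t ^+ _]/(t ^ _%:Z).
    by rewrite gez0_abs ?subr_ge0 ?imax // -expfzDr //; congr (t ^ _); lia.
  case: (eqVneq k l) => [->|_]; rewrite ?polyC0 ?polyC1 ?rmorph0 ?rmorph1.
    by rewrite mulr1 mul1r.
  by rewrite mul0r mulr0.
(* The combination v of the rows of N vanishes at 0, hence is divisible by X. *)
have DN : map_mx polyC D *m N = diag_mx e *m N'.
  apply/matrixP => k l; rewrite mul_diag_mx !mxE.
  under eq_bigr do rewrite !mxE.
  case: (eqVneq k i) => [_|_].
    have dvdX : 'X %| \sum_j v 0 j *: N j l.
      have := dvdp_XsubCl (\sum_j v 0 j *: N j l) 0; rewrite subr0 => ->.
      apply/eqP; rewrite horner_sum; have /rowP/(_ l) := vN.
      rewrite !mxE => E; rewrite -[RHS]E.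
      by apply: eq_bigr => j _; rewrite hornerZ !mxE.
    by rewrite [RHS]mulrC divpK //; apply: eq_bigr => j _; rewrite mul_polyC.
  rewrite mul1r (bigD1 k) //= eqxx mul1r big1 ?addr0 // => j.
  by rewrite eq_sym => /negPf ->; rewrite polyC0 mul0r.
have tw : twist r *m map_mx (@chart1 F) (diag_mx e) = twist r'.
  apply/matrixP => k l; rewrite mul_diag_mx !mxE /r'.
  case: (eqVneq k l) => [_|_]; last by rewrite !mulr0n rmorph0 mulr0.
  rewrite !mulr1n; case: eqP => [->|_]; last by rewrite rmorph1 mulr1.
  by rewrite chart1X expfzDr.
have detC : \det C = (\det D)%:P.
  have /(congr1 determinant) := CD; rewrite !det_mulmx mulrC => /mulfI E.
  apply: chart0_inj; rewrite -!det_map_mx; apply: E.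
  by rewrite det_twist expfz_neq0.
have Cu : C \in unitmx.
  by rewrite unitmxE detC poly_unitE size_polyC detD coefC unitfE detD.
have detN' : \det N' = (\det D * c) *: 'X^m.
  have /(congr1 determinant) := DN; rewrite !det_mulmx detN det_map_mx det_diag.
  have -> : \prod_k e 0 k = 'X.
    by rewrite (bigD1 i) //= mxE eqxx big1 ?mulr1 // => k /negPf ki; rewrite mxE ki.
  rewrite exprS -[X in _ = X]mulrC -scalerAr [_ *: _]scalerAr => E.
  apply: (@mulIf _ ('X : {poly F})); rewrite ?polyX_eq0 // -E -!mul_polyC polyCM; ring.
have [|U [N'' [r'' [Uu Nu E]]]] := IH (\det D * c) N' r' _ detN'.
  by rewrite mulf_neq0.
exists (invmx C *m U), N'', r''; split => //; first by rewrite unitmx_mul unitmx_inv Cu.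
rewrite map_mxM /= -[in RHS]mulmxA -[RHS]mulmxA [X in _ = _ *m X]mulmxA -E.
rewrite -tw -[twist r *m _ *m _]mulmxA -map_mxM -DN map_mxM -map_chartC.
rewrite [twist r *m (_ *m _)]mulmxA -CD !mulmxA -map_mxM /=.
by rewrite mulVmx // map_mx1 mul1mx.
Qed.

(** Birkhoff factorisation, that is Grothendieck's splitting of a bundle on the
    projective line as a sum of line bundles.  Twisting by a high power of t
    makes the transition matrix polynomial in 1/t; row reduction then removes the
    zeros of its determinant at infinity one at a time. *)
Lemma splitting n (E : vbundle F n) d : has_degree E d ->
  exists U N (r : 'I_n -> int), [/\ U \in unitmx, N \in unitmx,
    trans E = map_mx (@chart0 F) U *m twist r *m map_mx (@chart1 F) N &
    \sum_i r i = d].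
Proof.
case=> c c0 detT; have tn0 := tvar_neq0 F.
have [M Mlau] := fin_all_exists (fun ij : 'I_n * 'I_n =>
  laurent_chart1_shift (trans_laurent E ij.1 ij.2)).
pose S := \max_ij M ij.
have [q qE] := fin_all_exists (fun ij => Mlau ij S (leq_bigmax ij)).
pose N : 'M[{poly F}]_n := \matrix_(i, j) q (i, j).
have TE : trans E = twist (fun=> S%:Z) *m map_mx (@chart1 F) N.
  by apply/matrixP => i j; rewrite mul_diag_mx !mxE -qE.
have detN : chart0 c%:P * t ^ d = chart1 (\det N) * t ^ (\sum_(i < n) S%:Z).
  by rewrite -detT TE det_mulmx det_twist det_map_mx mulrC.
have := gluing_degree0 _ detN; rewrite polyC_eq0 => /(_ c0).
rewrite size_polyC c0 => le_d.
have [m mE] : exists m : nat, \sum_(i < n) S%:Z = d + m%:Z.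
  by exists (absz (\sum_(i < n) S%:Z - d)%R); lia.
have {}detN : \det N = c *: 'X^m.
  apply: chart1_inj; apply: (@mulIf _ (t ^ (\sum_(i < n) S%:Z))).
    by rewrite expfz_neq0.
  rewrite -detN -mul_polyC rmorphM rmorphXn /= chart1C chart1X mE -mulrA; congr (_ * _).
  rewrite exprVn addrC (expfzDr _ _ tn0); apply/esym.
  exact: (mulKf (expf_neq0 m tn0)).
have [U [N' [r [Uu Nu EN]]]] := row_reduction (fun=> S%:Z) c0 detN.
exists U, N', r; split => //; first by rewrite TE EN.
move: Uu Nu; rewrite !unitmxE => /unit_polyP [u u0 detU] /unit_polyP [w w0 detN'].
move: detT; rewrite TE EN !det_mulmx det_twist !det_map_mx detU detN' /= chart1C chart0C.
rewrite mulrAC -tofracM -polyCM; apply: tvar_expz_inj.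
by rewrite mulf_neq0.
Qed.

End Splitting.

(** * Maps to line bundles *)

Section LineMaps.
Variable F : fieldType.

Local Notation t := (tvar F).
(** The maps E -> O(e), given by a row on each chart and glued by the transition
    function t ^ e of O(e). *)
Definition line_map n (E : vbundle F n) (e : int)
    (phi : 'rV[{poly F}]_n * 'rV[{poly F}]_n) : Prop :=
  map_mx (@chart0 F) phi.1 *m trans E = t ^ e *: map_mx (@chart1 F) phi.2.

(** h^0(O(e)): the sections of O(e) are the polynomials of degree at most e. *)
Definition h0 (e : int) : nat := if 0 <= e + 1 then absz (e + 1)%R else 0%N.

Lemma line_map_section n (E : vbundle F n) e phi s :
  line_map E e phi -> H0 E s ->
  chart0 ((phi.1 *m s.1) 0 0) = chart1 ((phi.2 *m s.2) 0 0) * t ^ e.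
Proof.
move=> phiE sE; have : map_mx (@chart0 F) (phi.1 *m s.1) =
    t ^ e *: map_mx (@chart1 F) (phi.2 *m s.2).
  by rewrite map_mxM sE mulmxA phiE -scalemxAl map_mxM.
by move/matrixP/(_ 0 0); rewrite [LHS]mxE [X in _ = X -> _]mxE [in RHS]mxE mulrC => ->.
Qed.

Lemma line_map_neq0 n (E : vbundle F n) e phi :
  line_map E e phi -> phi.1 != 0 -> phi.2 != 0.
Proof.
move=> phiE; apply: contra_neq => phi2.
move: phiE; rewrite /line_map phi2 map_mx0 scaler0.
have [B _ TB] := trans_invertible E => /(congr1 (mulmx^~ B)).
rewrite -mulmxA TB mulmx1 mul0mx => /matrixP phi1.
apply/matrixP => i j; have := phi1 i j; rewrite !mxE => /eqP.
by rewrite chart0_eq0 => /eqP.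
Qed.

(** The inequality half of Riemann-Roch for the twisted dual of a bundle: a sum
    of line bundles O(r_i) has enough coordinate functionals with monomial
    coefficients. *)
Lemma riemann_roch n (E : vbundle F n) d e : has_degree E d ->
  exists (I : finType) (phi : I -> 'rV[{poly F}]_n * 'rV[{poly F}]_n),
  [/\ n%:Z * e - d + n%:Z <= #|I|%:Z, forall i, line_map E e (phi i) &
      forall c : I -> F, \sum_i (c i)%:P *: (phi i).1 = 0 -> forall i, c i = 0].
Proof.
move=> /splitting [U [N [r [Uu Nu TE rd]]]]; have tn0 := tvar_neq0 F.
pose I := {i : 'I_n & 'I_(h0 (e - r i))}.
pose phi (x : I) : 'rV[{poly F}]_n * 'rV[{poly F}]_n :=
  ('X^(tagged x) *: (delta_mx 0 (tag x) *m invmx U),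
   'X^(absz (e - r (tag x) - (tagged x : nat)%:Z)%R) *: (delta_mx 0 (tag x) *m N)).
exists I, phi; split.
- rewrite card_tagged sumnE big_map big_enum /= -rd.
  have -> : n%:Z * e - \sum_i r i + n%:Z = \sum_(i < n) (e - r i + 1).
    rewrite !big_split /= sumrN !sumr_const card_ord -[e *+ n]mulr_natl !natz; ring.
  rewrite rmorph_sum; apply: ler_sum => i _; rewrite card_ord /= /h0.
  by case: ifP => [e1|/negbT]; lia.
- move=> [i j]; rewrite /line_map /phi /= !map_mxZ !map_mxM /= TE.
  have ej : (j%:Z <= e - r i).
    by move: (nat_of_ord j) (ltn_ord j) => {j} l; rewrite /h0; case: ifP => [e1|_] //; lia.
  rewrite -scalemxAl !mulmxA -[_ *m map_mx _ (invmx U) *m _]mulmxA -map_mxM.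
  rewrite mulVmx // map_mx1 mulmx1 !map_delta_mx scalerA !scalemxAl.
  congr (_ *m _); apply/rowP => k; rewrite mul_mx_diag !mxE !eqxx /=.
  case: (eqVneq k i) => [->|_]; last by rewrite !mulr0 ?mul0r ?mulr0.
  rewrite !rmorphXn /= chart0X chart1X !mulr1.
  rewrite exprVn exprnN -[t ^+ _]/(t ^ j%:Z) -!expfzDr //; congr (t ^ _).
  by move: (nat_of_ord j) ej => {j k} l; lia.
move=> c /(congr1 (mulmx^~ U)); rewrite mulmx_suml mul0mx => /rowP cE [i j].
have := cE i; rewrite summxE !mxE => /polyP/(_ j).
rewrite coef_sum coef0 (bigD1 (Tagged (fun i => 'I_(h0 (e - r i))) j : I)) //=.
rewrite big1 => [|[k l] kl].
  rewrite addr0 /phi /= -!scalemxAl -mulmxA mulVmx // mulmx1 scalerA !mxE !eqxx mulr1.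
  by rewrite mul_polyC coefZ coefXn eqxx mulr1.
rewrite /phi /= -!scalemxAl -mulmxA mulVmx // mulmx1 scalerA !mxE !eqxx /=.
case: (eqVneq i k) => [ik|_]; last by rewrite mulr0 coef0.
subst k; rewrite mulr1 mul_polyC coefZ coefXn.
case: eqP => [/val_inj jl|_]; last by rewrite mulr0.
by move: kl; rewrite jl eqxx.
Qed.

(** Composing a map to O(e) with a section of E gives a section of O(e), so each
    section imposes [h0 e] linear conditions on the map. *)
Lemma line_map_killing n (E : vbundle F n) d e k (s : 'I_k -> local_sections F n) :
  has_degree E d -> (forall j, H0 E (s j)) ->
  (k * h0 e)%N%:Z < n%:Z * e - d + n%:Z ->
  exists phi, [/\ line_map E e phi, phi.1 != 0 & forall j, phi.1 *m (s j).1 = 0].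
Proof.
move=> Ed sE lt_k; have [I [phi [cardI phiE free]]] := riemann_roch e Ed.
pose J : finType := ('I_k * 'I_(h0 e))%type.
pose A : 'M[F]_(#|I|, #|J|) := \matrix_(a, z)
  (((phi (enum_val a : I)).1 *m (s (enum_val z : J).1).1) 0 0)`_((enum_val z : J).2).
have /rowV0Pn [v /sub_kermxP vA vn0] : kermx A != 0.
  rewrite kermx_eq0 /row_free neq_ltn; apply/orP; left.
  apply: leq_ltn_trans (rank_leq_col _) _; rewrite card_prod !card_ord; lia.
pose c i := v 0 (enum_rank i).
pose psi := (\sum_i (c i)%:P *: (phi i).1, \sum_i (c i)%:P *: (phi i).2).
have psiE : line_map E e psi.
  rewrite /line_map /psi /= !raddf_sum mulmx_suml /=; apply: eq_bigr => i _.
  by rewrite !map_mxZ /= -scalemxAl phiE !scalerA chart1C chart0C mulrC.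
exists psi; split => // [|j].
  apply: contra vn0 => /eqP psi0; apply/eqP/rowP => a; rewrite mxE.
  by rewrite -[a]enum_valK; apply: (free c).
have p0 : (psi.1 *m (s j).1) 0 0 = 0.
  apply/eqP; apply/negPn/negP => pn0.
  have szp : (size ((psi.1 *m (s j).1) 0 0))%:Z + 0 <= 1 + e.
    apply: (gluing_degree0 (g1 := (psi.2 *m (s j).2) 0 0)) => //.
    rewrite expr0z mulr1; exact: (line_map_section psiE (sE j)).
  move/eqP: pn0; apply; apply/polyP => l; rewrite coef0.
  have [lt_l|ge_l] := ltnP l (h0 e); last first.
    rewrite nth_default //; apply: leq_trans ge_l; move: (size _) szp => sz.
    by rewrite /h0; case: ifP => [e1|/negbT e1] szp; lia.
  have /rowP/(_ (enum_rank (j, Ordinal lt_l))) E0 := vA; rewrite !mxE in E0.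
  rewrite -[RHS]E0 /psi /= mulmx_suml summxE coef_sum.
  rewrite (reindex (enum_val : 'I_#|I| -> I)) /=; last exact/onW_bij/enum_val_bij.
  apply: eq_bigr => a _; rewrite -scalemxAl mxE coefCM /c enum_valK !mxE.
  by rewrite enum_rankK.
by apply/matrixP => i i'; rewrite !ord1 p0 mxE.
Qed.

(** Euclid's algorithm by column operations: after division by the first entry,
    either the remaining entries vanish, or one of them has smaller degree and is
    moved to the front. *)
Lemma row_gcd m (phi : 'rV[{poly F}]_(1 + m)) : phi != 0 ->
  exists U g, [/\ U \in unitmx, g != 0 & phi *m U = row_mx (g%:M : 'M_1) 0].
Proof.
have entry00 k (psi : 'rV[{poly F}]_(1 + m)) :
    (psi *m tperm_mx (lshift m 0) k) 0 (lshift m 0) = psi 0 k.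
  by rewrite -xcolE mxE tpermL.
have tperm_unit (k : 'I_(1 + m)) : tperm_mx (R := {poly F}) (lshift m (0 : 'I_1)) k \in unitmx.
  exact: unitmx_perm.
suff step (N : nat) (psi : 'rV[{poly F}]_(1 + m)) : psi 0 (lshift m 0) != 0 ->
    (size (psi 0 (lshift m 0))%R <= N)%N ->
    exists U g, [/\ U \in unitmx, g != 0 & psi *m U = row_mx (g%:M : 'M_1) 0].
  move=> /rV0Pn [k phik].
  have [|U [g [Uu g0 E]]] := step _ (phi *m tperm_mx (lshift m 0) k) _ (leqnn _).
  - by rewrite entry00.
  by exists (tperm_mx (lshift m 0) k *m U), g; rewrite unitmx_mul tperm_unit mulmxA.
elim: N psi => [|N IH] psi; first by rewrite leqn0 size_poly_eq0 => /negPf ->.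
move=> a0 sza; set a := psi 0 _ in a0 sza.
pose w := rsubmx psi; pose q := map_mx (fun p => p %/ a) w.
pose U1 : 'M[{poly F}]_(1 + m) := block_mx 1%:M (- q) 0 1%:M.
have U1u : U1 \in unitmx by rewrite unitmxE det_ublock !det1 mulr1 unitr1.
have psiE : psi *m U1 = row_mx a%:M (map_mx (fun p => p %% a) w).
  rewrite -[psi]hsubmxK mul_row_block mulmx0 mulmx1 addr0 mulmx1.
  have -> : lsubmx psi = a%:M by rewrite [LHS]mx11_scalar mxE.
  congr row_mx; apply/rowP => j; rewrite mul_scalar_mx !mxE.
  by rewrite {2}(divp_eq (psi 0 (rshift 1 j)) a); ring.
have [w0|] := eqVneq (map_mx (fun p => p %% a) w) 0.
  by exists U1, a; rewrite psiE w0.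
move=> /rV0Pn [k wk].
have E0 : (psi *m U1 *m tperm_mx (lshift m 0) (rshift 1 k)) 0 (lshift m 0) =
    (w 0 k) %% a by rewrite entry00 psiE row_mxEr mxE.
have [||U [g [Uu g0 E]]] := IH (psi *m U1 *m tperm_mx (lshift m 0) (rshift 1 k)).
- by move: wk; rewrite E0 mxE.
- by rewrite E0 -ltnS (leq_trans _ sza) // ltn_modp.
exists (U1 *m tperm_mx (lshift m 0) (rshift 1 k) *m U), g.
by rewrite !unitmx_mul U1u tperm_unit Uu !mulmxA.
Qed.

End LineMaps.

(** * Kernels of maps to line bundles *)

Section Kernels.
Variable F : fieldType.

Local Notation t := (tvar F).
Local Notation ev x := (fun p : {poly F} => p.[x]).

Lemma rank_left_inverse (K : fieldType) m n (A : 'M[K]_(m, n)) (B : 'M[K]_(n, m)) :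
  A *m B = 1%:M -> \rank B = m.
Proof.
move=> AB; apply/eqP; rewrite eqn_leq rank_leq_col /=.
by rewrite -{1}(mxrank1 K m) -AB mxrankM_maxr.
Qed.

Lemma rank_fibre_left_inverse m n (A : 'M[{poly F}]_(m, n)) (B : 'M[{poly F}]_(n, m)) x :
  A *m B = 1%:M -> \rank (map_mx (ev x) B) = m.
Proof.
move=> AB; apply: (rank_left_inverse (A := map_mx (horner_eval x) A)).
by rewrite -[map_mx (ev x) B]/(map_mx (horner_eval x) B) -map_mxM AB map_mx1.
Qed.

(* A generator g of the ideal of the entries of phi, with the column operations U
   that reduce phi to it: the last columns of U are a basis of the kernel. *)
Section Chart.
Variables (m : nat) (phi : 'rV[{poly F}]_(1 + m)) (U : 'M[{poly F}]_(1 + m)) (g : {poly F}).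
Hypotheses (Uu : U \in unitmx) (phiU : phi *m U = row_mx (g%:M : 'M_1) 0).

Lemma row_gcd_kernel : phi *m rsubmx U = 0.
Proof. by rewrite mulmx_rsub phiU row_mxKr. Qed.

Lemma row_gcd_rank x : \rank (map_mx (ev x) (rsubmx U)) = m.
Proof.
apply: (rank_fibre_left_inverse (A := dsubmx (invmx U))).
rewrite mulmx_rsub mul_dsub_mx mulVmx // scalar_mx_block.
exact: (block_mxKdr (1%:M : 'M_1) 0 0 1%:M).
Qed.

Lemma row_gcd_lift (s : 'cV_(1 + m)) : g != 0 -> phi *m s = 0 ->
  invmx U *m s = col_mx 0 (dsubmx (invmx U *m s)) /\
  rsubmx U *m dsubmx (invmx U *m s) = s.
Proof.
move=> g0 phis; set w := invmx U *m s.
have wE : w = col_mx 0 (dsubmx w).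
  rewrite -[LHS]vsubmxK; congr col_mx.
  have : phi *m U *m w = 0 by rewrite -mulmxA /w mulKVmx.
  rewrite phiU -{1}[w]vsubmxK mul_row_col mul0mx addr0 mul_scalar_mx => /eqP.
  by rewrite scalemx_eq0 (negPf g0) => /eqP.
split=> //; have -> : rsubmx U *m dsubmx w = U *m w.
  by rewrite {2}wE -[U in RHS]hsubmxK mul_row_col mulmx0 add0r.
by rewrite mulKVmx.
Qed.

Lemma row_gcd_unimodular (c : F) : c != 0 -> g != 0 ->
  (size (c%:P * g)%R <= 1)%N -> exists z : 'cV_(1 + m), phi *m z = 1%:M.
Proof.
move=> c0 g0; rewrite mul_polyC size_scale // => szg.
have [b gE] : exists b, g = b%:P by exists g`_0; apply: size1_polyC.
exists (b^-1%:P *: lsubmx U).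
rewrite -scalemxAr mulmx_lsub phiU row_mxKl gE scale_scalar_mx -polyCM mulVf //.
by move: g0; rewrite gE polyC_eq0.
Qed.

End Chart.

(** The saturated kernel of a nonzero map E -> O(e).  Its image is O(e - j),
    where j counts the zeros of the map with multiplicity, so the kernel has
    degree d - e + j; and when j = 0 the map is onto, hence has a local section
    on each chart. *)
Lemma kernel_subbundle m (E : vbundle F m.+1) d e phi :
  has_degree E d -> line_map E e phi -> phi.1 != 0 ->
  exists (K : vbundle F m) (d' : int) (f : bundle_hom K E),
  [/\ has_degree K d' /\ d - e <= d', subbundle f,
      phi.1 *m hom0 f = 0 /\ phi.2 *m hom1 f = 0,
      (forall s, H0 E s -> phi.1 *m s.1 = 0 ->
         exists2 s', H0 K s' & hom_sections f s' = s) &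
      d' = d - e -> (exists z0, phi.1 *m z0 = 1%:M) /\
                    (exists z1, phi.2 *m z1 = 1%:M)].
Proof.
move=> Ed phiE phi1; have phi2 := line_map_neq0 phiE phi1; have tn0 := tvar_neq0 F.
have [U0 [g0 [U0u g0n0 E0]]] := row_gcd (m := m) phi1.
have [U1 [g1 [U1u g1n0 E1]]] := row_gcd (m := m) phi2.
have [B lB TB] := trans_invertible E; have lT := trans_laurent E.
set T := trans E in TB lT phiE.
pose c0 k l (A : 'M[{poly F}]_(k, l)) := map_mx (@chart0 F) A.
pose c1 k l (A : 'M[{poly F}]_(k, l)) := map_mx (@chart1 F) A.
have lc0 k l (A : 'M[{poly F}]_(k, l)) i j : laurent (c0 _ _ A i j).
  by rewrite mxE; apply: laurent_chart0.
have lc1 k l (A : 'M[{poly F}]_(k, l)) i j : laurent (c1 _ _ A i j).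
  by rewrite mxE; apply: laurent_chart1.
pose T' : 'M_(1 + m) := c0 _ _ (invmx U0) *m T *m c1 _ _ U1.
pose B' : 'M_(1 + m) := c1 _ _ (invmx U1) *m B *m c0 _ _ U0.
have lT' : forall i j, laurent (T' i j) by do 2!apply: laurent_mulmx => //.
have lB' : forall i j, laurent (B' i j) by do 2!apply: laurent_mulmx => //.
have TU : T *m c1 _ _ U1 = c0 _ _ U0 *m T'.
  by rewrite /T' !mulmxA -map_mxM /= mulmxV // map_mx1 mul1mx.
have TB' : T' *m B' = 1%:M.
  have -> : T' *m B' = c0 _ _ (invmx U0) *m (T *m (c1 _ _ U1 *m c1 _ _ (invmx U1)) *m B)
      *m c0 _ _ U0 by rewrite /T' /B' !mulmxA.
  rewrite -[c1 _ _ U1 *m _]map_mxM /= mulmxV // map_mx1 mulmx1 TB mulmx1.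
  by rewrite -map_mxM /= mulVmx // map_mx1.
pose a := ulsubmx T'; pose D := drsubmx T'.
(* In the reduced bases the map has components (g0, 0) and (g1, 0), so the
   transition matrix is block triangular. *)
have keyT : row_mx (c0 _ _ g0%:M) 0 *m T' = t ^ e *: row_mx (c1 _ _ g1%:M) (0 : 'M_(1, m)).
  have -> : row_mx (c0 _ _ g0%:M) 0 = c0 _ _ phi.1 *m c0 _ _ U0.
    by rewrite -map_mxM /= E0 /c0 map_row_mx map_mx0.
  rewrite -mulmxA -TU mulmxA phiE -scalemxAl -map_mxM /= E1.
  by rewrite map_row_mx map_mx0.
move: keyT; rewrite -{1}[T']submxK mul_row_block !mul0mx !addr0 scale_row_mx scaler0.
rewrite /c0 /c1 !map_scalar_mx /= !mul_scalar_mx => /eq_row_mx [aE /eqP].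
rewrite scalemx_eq0 chart0_eq0 (negPf g0n0) /= => /eqP ur0.
have {}aE : chart0 g0 * a 0 0 = t ^ e * chart1 g1.
  by have /matrixP/(_ 0 0) := aE; rewrite !mxE eqxx mulr1n.
have an0 : a 0 0 != 0.
  apply: contra_neq phi2 => a0; move/eqP: aE; rewrite a0 mulr0 eq_sym mulf_eq0.
  by rewrite expfz_eq0 (negPf tn0) andbF chart1_eq0 (negPf g1n0).
have T'E : T' = block_mx a 0 (dlsubmx T') D by rewrite -ur0 submxK.
have DB : D *m drsubmx B' = 1%:M.
  move: TB'; rewrite {1}T'E -{1}[B']submxK mulmx_block (scalar_mx_block 1 m).
  case/eq_block_mx => _ /eqP + _ <-; rewrite mul0mx addr0 [a]mx11_scalar mul_scalar_mx.
  by rewrite scalemx_eq0 (negPf an0) /= => /eqP ->; rewrite mulmx0 add0r.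
have lD i j : laurent (D i j).
  by have := lT' (rshift 1 i) (rshift 1 j); rewrite T'E block_mxEdr.
have lDB i j : laurent (drsubmx B' i j).
  by have := lB' (rshift 1 i) (rshift 1 j); rewrite -{1}[B']submxK block_mxEdr.
pose K := VBundle lD (ex_intro2 _ _ (drsubmx B') lDB DB).
have f_compat : c0 _ _ (rsubmx U0 : 'M_(m.+1, m)) *m trans K =
    trans E *m c1 _ _ (rsubmx U1 : 'M_(m.+1, m)).
  transitivity (rsubmx (T *m c1 _ _ U1)); last by rewrite -mulmx_rsub /c1 map_rsubmx.
  rewrite TU T'E -[c0 _ _ U0]hsubmxK mul_row_block.
  by rewrite row_mxKr mulmx0 add0r /c0 map_rsubmx.
have [c cn0 [d' detD]] : exists2 c : F, c != 0 & exists d' : int,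
    \det D = tofrac c%:P * t ^ d'.
  apply: (laurent_unit (y := \det (drsubmx B'))); try exact: laurent_det.
  by rewrite -det_mulmx DB det1.
(* Comparing determinants: up to constants, g0 t ^ d = g1(1/t) t ^ (e + d'). *)
have [w wn0 [w' w'n0 glue]] : exists2 w : F, w != 0 & exists2 w' : F, w' != 0 &
    chart0 (w%:P * g0) * t ^ d = chart1 (w'%:P * g1) * t ^ (e + d').
  have [b b0 detE] := Ed; move: U0u U1u; rewrite -unitmx_inv !unitmxE.
  move=> /unit_polyP [u0 u0n0 detU0] /unit_polyP [u1 u1n0 detU1].
  exists (u0 * b * u1); first by rewrite !mulf_neq0.
  exists c => //; move: (congr1 determinant T'E).
  rewrite det_lblock !det_mulmx !det_map_mx detU0 detU1 /= -/T detE detD chart1C chart0C.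
  rewrite [a]mx11_scalar det_scalar1 => /(congr1 ( *%R (chart0 g0))).
  rewrite [RHS]mulrA aE !polyCM !rmorphM /= chart1C (expfzDr _ _ tn0) => E2.
  have ac1 (x y z g s : ratfun F) : x * y * z * g * s = g * (x * (y * s) * z) by ring.
  have ac2 (x y z s : ratfun F) : x * y * (z * s) = z * y * (x * s) by ring.
  by rewrite ac1 E2 ac2.
have szc g (b : F) : g != 0 -> b != 0 -> (0 < size (b%:P * g)%R)%N.
  by move=> gn0 bn0; rewrite size_poly_gt0 mulf_neq0 // polyC_eq0.
have glue0 := gluing_degree0 _ glue; have glue1 := gluing_degree1 _ glue.
have sz0 := szc _ _ g0n0 wn0; have sz1 := szc _ _ g1n0 w'n0.
move: glue0 glue1; rewrite -!size_poly_gt0 sz0 sz1 => /(_ isT) glue0 /(_ isT) glue1.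
exists K, d', (BundleHom f_compat); split => /=.
- split; first by exists c.
  by clear -glue0 sz0; move: (size _) glue0 sz0 => z; lia.
- by move=> x; split; apply: row_gcd_rank; eassumption.
- by split; apply: row_gcd_kernel; eassumption.
- move=> s sE phis.
  have phis1 : phi.2 *m s.2 = 0.
    have /eqP := line_map_section phiE sE; rewrite phis mxE rmorph0 eq_sym mulf_eq0.
    rewrite expfz_eq0 (negPf tn0) andbF orbF chart1_eq0 => /eqP p0.
    by apply/matrixP => i j; rewrite !ord1 p0 mxE.
  have [l0 r0] := row_gcd_lift U0u E0 g0n0 phis.
  have [l1 r1] := row_gcd_lift U1u E1 g1n0 phis1.
  exists (dsubmx (invmx U0 *m s.1), dsubmx (invmx U1 *m s.2)); last first.
    by rewrite /hom_sections /= r0 r1; case: (s).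
  rewrite /H0 /=.
  have : c0 _ _ (invmx U0 *m s.1) = T' *m c1 _ _ (invmx U1 *m s.2).
    rewrite /c0 /c1 !map_mxM /= sE /T' !mulmxA; congr (_ *m _).
    by rewrite -!mulmxA -map_mxM /= mulmxV // map_mx1 mulmx1.
  rewrite {1}l0 {1}l1 T'E /c0 /c1 !map_col_mx !map_mx0 mul_block_col mulmx0 add0r.
  by case/eq_col_mx => _ ->; rewrite mulmx0 add0r.
move=> d'E; split.
  apply: (row_gcd_unimodular E0 wn0 g0n0).
  by clear -glue0 d'E; move: (size _) glue0 => z; lia.
apply: (row_gcd_unimodular E1 w'n0 g1n0).
by clear -glue1 d'E; move: (size _) glue1 => z; lia.
Qed.
End Kernels.

(** * Consequences of stability *)

Section LinearCombinations.
Variable F : fieldType.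

Lemma lin_comb_comp n k l (c : 'I_k -> F) (C : 'M[F]_(k, l))
    (b : 'I_l -> local_sections F n) :
  lin_comb c (fun i => lin_comb (C i) b) =
  lin_comb (fun j => \sum_i c i * C i j) b.
Proof.
by congr pair => /=; under eq_bigr do rewrite scaler_sumr; rewrite exchange_big /=;
  apply: eq_bigr => j _; rewrite raddf_sum scaler_suml /=; apply: eq_bigr => i _;
  rewrite scalerA polyCM.
Qed.

Lemma lin_comb_delta n k (b : 'I_k -> local_sections F n) i :
  lin_comb (fun j => (j == i)%:R) b = b i.
Proof.
have E (V : lmodType {poly F}) (v : 'I_k -> V) :
    \sum_j (((j == i)%:R)%:P : {poly F}) *: v j = v i.
  rewrite (bigD1 i) //= eqxx scale1r big1 ?addr0 // => j /negPf ->.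
  by rewrite scale0r.
by rewrite /lin_comb !E; case: (b i).
Qed.

Lemma hom_sections_lin_comb m n (E : vbundle F m) (E' : vbundle F n)
    (f : bundle_hom E E') k (c : 'I_k -> F) (b : 'I_k -> local_sections F m) :
  hom_sections f (lin_comb c b) = lin_comb c (fun i => hom_sections f (b i)).
Proof.
by congr pair; rewrite /= mulmx_sumr; apply: eq_bigr => i _; rewrite scalemxAr.
Qed.

Lemma H0_lin_comb n (E : vbundle F n) k (c : 'I_k -> F)
    (b : 'I_k -> local_sections F n) :
  (forall i, H0 E (b i)) -> H0 E (lin_comb c b).
Proof.
move=> bE; rewrite /H0 /lin_comb /= !raddf_sum /=; apply: eq_bigr => i _.
by rewrite !map_mxZ /= bE chart1C chart0C scalemxAr.
Qed.

Lemma cs_space_lin_comb n d k (S : coherent_system F n d k) l (c : 'I_l -> F)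
    (b : 'I_l -> local_sections F n) :
  (forall i, cs_space S (b i)) -> cs_space S (lin_comb c b).
Proof.
have [e [_ ->]] := cs_space_dim S => bE.
have [C CE] := fin_all_exists bE.
pose M : 'M[F]_(l, k) := \matrix_(i, j) C i j.
exists (fun j => \sum_i c i * M i j); rewrite -lin_comb_comp.
congr (lin_comb c _); apply: funext => i; rewrite CE; congr (lin_comb _ e).
by apply: funext => j; rewrite mxE.
Qed.

Lemma cs_basis n d k (S : coherent_system F n d k) :
  exists b : 'I_k -> local_sections F n,
  [/\ forall c, lin_comb c b = (0, 0) -> forall i, c i = 0,
      cs_space S = [set s | exists c, s = lin_comb c b] &
      forall i, cs_space S (b i)].
Proof.
have [b [free VE]] := cs_space_dim S; exists b; split=> // i.
by rewrite VE; exists (fun j => (j == i)%:R); rewrite lin_comb_delta.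
Qed.

(** Linear forms on a space of dimension k + 1 vanish on a subspace of dimension
    k, whose basis is listed by the rows of [M]. *)
Lemma mx_killing k (x : 'cV[F]_k.+1) :
  exists2 M : 'M[F]_(k, k.+1), row_free M & M *m x = 0.
Proof.
have rk : (k <= \rank (kermx x))%N.
  by rewrite mxrank_ker; have := rank_leq_col x; lia.
exists (pid_mx k *m row_base (kermx x)).
  rewrite /row_free mxrankMfree ?row_base_free // rank_pid_mx //.
have /sub_kermxP K0 : (row_base (kermx x) <= kermx x)%MS by rewrite eq_row_base.
by rewrite -mulmxA K0 mulmx0.
Qed.

End LinearCombinations.

Section Stability.
Variables (F : fieldType) (R : realType).
Implicit Types alpha : R.

Lemma mu_lt alpha m n (d d' : int) k k' : (0 < m)%N -> (0 < n)%N ->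
  (mu alpha m d k < mu alpha n d' k') =
  ((d%:~R + alpha * k%:R) * n%:R < (d'%:~R + alpha * k'%:R) * m%:R).
Proof.
move=> m0 n0; have m0' : (0 : R) < m%:R by rewrite ltr0n.
have n0' : (0 : R) < n%:R by rewrite ltr0n.
rewrite /mu !mulrA -!mulrDl ltr_pdivrMr // mulrAC -ltr_pdivlMr //.
Qed.

(** The subsystem (E, 0) is proper and has slope d / n. *)
Lemma stable_alpha_gt0 alpha n d k (S : coherent_system F n.+1 d k.+1) :
  alpha_stable alpha S -> 0 < alpha.
Proof.
move=> stS; have [b [free VE _]] := cs_basis S.
pose b0 (i : 'I_0) : local_sections F n.+1 := (0, 0).
have lc0 c : lin_comb c b0 = (0, 0) by rewrite /lin_comb !big_ord0.
pose V0 : set (local_sections F n.+1) := [set s | exists c, s = lin_comb c b0].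
have V0sub : V0 `<=` H0 (cs_bundle S).
  by move=> s [c ->]; rewrite lc0 /H0 /= !map_mx0 mulmx0.
have V0dim : subspace_of_dim 0 V0 by exists b0; split=> // c _ [].
pose S0 := CoherentSystem (cs_degree S) V0sub V0dim.
have id_compat : map_mx (@chart0 F) 1%:M *m trans (cs_bundle S0) =
    trans (cs_bundle S) *m map_mx (@chart1 F) 1%:M.
  by rewrite !map_mx1 mul1mx mulmx1.
pose f := BundleHom id_compat.
have : mu alpha n.+1 d 0 < mu alpha n.+1 d k.+1.
  apply: (stS _ _ _ S0 f).
    split=> // [x|s [_ [c ->] <-]].
      by split; apply: (rank_fibre_left_inverse (A := 1%:M)); rewrite mul1mx.
    rewrite lc0 /hom_sections /= !mulmx0.
    rewrite VE; exists (fun=> 0); rewrite /lin_comb.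
    by rewrite !big1 // => i _; rewrite scale0r.
  move=> [_ fV].
  have : cs_space S (lin_comb (fun j => (j == ord0)%:R) b) by rewrite VE; eexists.
  rewrite -fV => -[_ [c ->]]; rewrite lc0 /hom_sections /= !mulmx0 => /esym /free.
  by move=> /(_ ord0) /eqP; rewrite eqxx oner_eq0.
rewrite mu_lt // mulr0 addr0 ltr_pM2r ?ltr0n // ltrDl.
by rewrite pmulr_lgt0 // ltr0n.
Qed.

(** The kernel of a nonzero map E -> O(e), with the sections it contains, is a
    subsystem, of degree at least d - e. *)
Lemma stable_line_map alpha m d k (S : coherent_system F m.+1 d k) e phi l
    (b : 'I_l -> local_sections F m.+1) :
  (0 < m)%N -> alpha_stable alpha S ->
  line_map (cs_bundle S) e phi -> phi.1 != 0 ->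
  (forall c, lin_comb c b = (0, 0) -> forall i, c i = 0) ->
  (forall i, cs_space S (b i)) -> (forall i, phi.1 *m (b i).1 = 0) ->
  mu alpha m (d - e) l < mu alpha m.+1 d k.
Proof.
move=> m0 stS phiE phi1 free bV bphi.
have [K [d' [f [[Kd' le_d'] subf _ lift _]]]] :=
  kernel_subbundle (cs_degree S) phiE phi1.
have [b' b'E b'b] := fin_all_exists2 (fun i => lift _ (cs_space_sub (bV i)) (bphi i)).
pose V' : set (local_sections F m) := [set s | exists c, s = lin_comb c b'].
have fb' c : hom_sections f (lin_comb c b') = lin_comb c b.
  by rewrite hom_sections_lin_comb; congr lin_comb; apply: funext.
have V'sub : V' `<=` H0 K by move=> s [c ->]; apply: H0_lin_comb.
have V'dim : subspace_of_dim l V'.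
  exists b'; split=> // c c0; apply: free.
  by rewrite -fb' c0 /hom_sections /= !mulmx0.
pose S' := CoherentSystem Kd' V'sub V'dim.
have : mu alpha m d' l < mu alpha m.+1 d k.
  apply: (stS _ _ _ S' f).
    by split=> // s [_ [c ->] <-]; rewrite fb'; apply: cs_space_lin_comb.
  move=> [[g [fg _ _ _]] _].
  have /(congr1 (map_mx (horner_eval (0 : F)))) := fg; rewrite map_mxM map_mx1.
  move=> /(congr1 (fun M => \rank M)); rewrite mxrank1 => rk.
  set A := map_mx _ _ in rk; set B := map_mx _ (hom0 g) in rk.
  by have := leq_trans (mxrankM_maxr A B) (rank_leq_row B); rewrite rk ltnn.
apply: le_lt_trans; rewrite /mu lerD2r ler_pM2r ?invr_gt0 ?ltr0n // ler_int.
exact: le_d'.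
Qed.

(** A map E -> O restricts to a linear functional on the space of sections, so
    it kills a hyperplane in it. *)
Lemma hyperplane_killed n d k (S : coherent_system F n d k.+1) phi :
  line_map (cs_bundle S) 0 phi ->
  exists b : 'I_k -> local_sections F n,
  [/\ forall c, lin_comb c b = (0, 0) -> forall i, c i = 0,
      forall i, cs_space S (b i) & forall i, phi.1 *m (b i).1 = 0].
Proof.
move=> phiE; have [b [free _ bV]] := cs_basis S.
have cst i : exists x, phi.1 *m (b i).1 = (x%:P)%:M.
  have pE := line_map_section phiE (cs_space_sub (bV i)).
  exists (((phi.1 *m (b i).1) 0 0)`_0); rewrite {1}[phi.1 *m _]mx11_scalar.
  congr (_%:M); set p := (phi.1 *m _) 0 0 in pE *.
  have [->|p0] := eqVneq p 0; first by rewrite coef0 polyC0.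
  have := gluing_degree0 (a := 0) p0 (etrans (mulr1 _) pE).
  by move=> szp; apply: size1_polyC; move: (size p) szp => z; lia.
have [x xE] := fin_all_exists cst.
have [M Mfree Mx] := mx_killing (\col_i x i).
exists (fun j => lin_comb (M j) b); split=> [c|i|i].
- rewrite lin_comb_comp => /free cM i.
  have : (\row_i c i) *m M = 0.
    by apply/rowP => j; rewrite !mxE -[RHS](cM j); apply: eq_bigr => l _; rewrite mxE.
  by rewrite -(mul0mx _ M) => /(row_free_inj Mfree) /rowP/(_ i); rewrite !mxE.
- exact: cs_space_lin_comb.
rewrite /lin_comb /= mulmx_sumr.
have /matrixP/(_ i 0) := Mx; rewrite !mxE => Mxi.
transitivity (((\sum_j M i j * x j)%:P : {poly F})%:M : 'M_1).
  rewrite !raddf_sum /=; apply: eq_bigr => j _.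
  by rewrite -scalemxAr xE scale_scalar_mx polyCM.
rewrite (_ : \sum_j _ = 0) ?polyC0 ?scalemx0 ?raddf0 //.
by rewrite -[RHS]Mxi; apply: eq_bigr => j _; rewrite mxE.
Qed.

(** Maps to O(e) with e = d, with e <= d / n and with e = 0 give in turn alpha < d,
    d >= 0 and d >= n. *)
Lemma stable_bounds alpha m d (S : coherent_system F m.+2 d m.+1) :
  alpha_stable alpha S -> m.+2%:Z <= d /\ alpha < d%:~R.
Proof.
move=> stS; have a0 := stable_alpha_gt0 stS.
have [b [free _ bV]] := cs_basis S.
have bE i := cs_space_sub (bV i).
have m1 : (0 : R) <= m%:R by [].
have [d0|d0] := leP 0 d; last first.
  (* d < 0: a map to a line bundle of negative degree e <= d / n. *)
  pose e := (d %/ m.+2%:Z)%Z.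
  have dE := divz_eq d m.+2%:Z; rewrite -/e in dE.
  have rlt := ltz_pmod d (isT : 0 < m.+2%:Z).
  have r0 := modz_ge0 d (isT : m.+2%:Z != 0).
  have e0 : h0 e = 0%N by rewrite /h0; case: ifP => // e1; nia.
  have [|phi [phiE phi1 phib]] := line_map_killing (e := e) (cs_degree S) bE.
    by rewrite e0 muln0; nia.
  have := stable_line_map (ltn0Sn _) stS phiE phi1 free bV phib.
  have ne : (e * m.+2%:Z)%:~R <= d%:~R :> R by rewrite ler_int; lia.
  have am := mulr_ge0 (ltW a0) m1.
  have {}ne : e%:~R * (m%:R + 1 + 1) <= d%:~R :> R.
    by move: ne; rewrite rmorphM /= -[(Posz _)%:~R]/(m.+2%:R : R) -!natr1.
  rewrite mu_lt // rmorphB /= -!natr1.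
  move: (e%:~R) (d%:~R) (m%:R) ne m1 am => e' d' m' *; nra.
have ad : alpha < d%:~R.
  (* A map to O(d) that kills the whole space of sections. *)
  have hd : h0 d = (absz d).+1 by rewrite /h0; case: ifP => d1; lia.
  have [|phi [phiE phi1 phib]] := line_map_killing (e := d) (cs_degree S) bE.
    by rewrite hd; nia.
  have := stable_line_map (ltn0Sn _) stS phiE phi1 free bV phib.
  by rewrite subrr mu_lt // -!natr1; nra.
split=> //; rewrite leNgt; apply/negP => dn.
(* d < n: a map to O. *)
have [||phi [phiE phi1 _]] := line_map_killing (k := 0) (s := fun=> (0, 0))
  (e := 0) (cs_degree S).
- by case.
- by rewrite mulr0 mul0n; lia.
have [b' [free' b'V b'phi]] := hyperplane_killed phiE.
have := stable_line_map (ltn0Sn _) stS phiE phi1 free' b'V b'phi.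
by rewrite subr0 mu_lt // -!natr1; nra.
Qed.

End Stability.

(** * The universal extension *)

Section Extension.
Variables (F : fieldType) (m : nat) (d : int).

Local Notation t := (tvar F).

Definition ext_class : 'cV[ratfun F]_m.+1 := \col_i t ^+ i.+1.

(** In these coordinates O(d) comes first and the trivial subbundle last, so that
    a section (y, x) is glued by y_0 = t ^ d y_1 and x_0 = t^(i+1) y_1 + x_1. *)
Definition ext_trans : 'M[ratfun F]_(1 + m.+1) :=
  block_mx (t ^ d)%:M 0 ext_class 1%:M.

Lemma ext_trans_laurent i j : laurent (ext_trans i j).
Proof.
have [l0 l1] := (laurent0 F, laurent1 F).
rewrite -[i]splitK -[j]splitK; case: (fintype.split i) => a; case: (fintype.split j) => b /=.
- by rewrite block_mxEul !ord1 mxE mulr1n; apply: laurent_tvar.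
- by rewrite block_mxEur mxE.
- by rewrite block_mxEdl mxE; apply: (laurent_tvar F a.+1).
- by rewrite block_mxEdr mxE; case: eqP.
Qed.

Lemma ext_trans_invertible : exists2 B : 'M[ratfun F]_(1 + m.+1),
  (forall i j, laurent (B i j)) & ext_trans *m B = 1%:M.
Proof.
pose B : 'M[ratfun F]_(1 + m.+1) := block_mx (t ^ (- d))%:M 0 (- t ^ (- d) *: ext_class) 1%:M.
have td : t ^ d * t ^ (- d) = 1 by rewrite -expfzDr ?subrr ?tvar_neq0.
exists B; last first.
  rewrite mulmx_block !mul0mx !mulmx0 !mul1mx !addr0 -scalar_mxM td add0r.
  by rewrite mul_mx_scalar scaleNr subrr -scalar_mx_block.
have [l0 l1] := (laurent0 F, laurent1 F).
move=> i j; rewrite -[i]splitK -[j]splitK.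
case: (fintype.split i) => a; case: (fintype.split j) => b /=.
- by rewrite block_mxEul !ord1 mxE mulr1n; apply: laurent_tvar.
- by rewrite block_mxEur mxE.
- rewrite block_mxEdl !mxE; apply: laurentM; last exact: (laurent_tvar F a.+1).
  rewrite -mulN1r; apply: laurentM; last exact: laurent_tvar.
  by rewrite -(rmorphN1 (@chart0 F)); apply: laurent_chart0.
- by rewrite block_mxEdr mxE; case: eqP.
Qed.

Definition ext_bundle : vbundle F m.+2 :=
  @VBundle F m.+2 ext_trans ext_trans_laurent ext_trans_invertible.

Lemma ext_degree : has_degree ext_bundle d.
Proof.
exists 1; rewrite ?oner_eq0 // polyC1 tofrac1 mul1r.
by rewrite [LHS](det_lblock (t ^ d)%:M ext_class 1%:M) det_scalar1 det1 mulr1.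
Qed.

Definition const_section (c : 'cV[F]_m.+1) : local_sections F m.+2 :=
  (col_mx (0 : 'M_1) (map_mx polyC c), col_mx (0 : 'M_1) (map_mx polyC c)).

Lemma lin_comb_const_section k (a : 'I_k -> F) (c : 'I_k -> 'cV[F]_m.+1) :
  lin_comb a (fun i => const_section (c i)) = const_section (\sum_i a i *: c i).
Proof.
have E : \sum_i (a i)%:P *: col_mx (0 : 'M_1) (map_mx polyC (c i)) =
    col_mx (0 : 'M_1) (map_mx polyC (\sum_i a i *: c i)).
  rewrite raddf_sum /=; transitivity (\sum_i col_mx (0 : 'M_1) (map_mx polyC (a i *: c i))).
    by apply: eq_bigr => i _; rewrite scale_col_mx scaler0 map_mxZ.
  elim/big_rec2: _ => [|i x y _ ->]; first by rewrite col_mx0.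
  by rewrite add_col_mx addr0.
by rewrite /lin_comb /const_section /= E.
Qed.

Lemma const_section_inj : injective const_section.
Proof.
move=> c c' /(congr1 (fun s => dsubmx (s.1 : 'cV_(1 + m.+1)))).
rewrite !col_mxKd => /matrixP E; apply/colP => i.
by have := E i 0; rewrite !mxE => /polyC_inj.
Qed.

Definition ext_space : set (local_sections F m.+2) :=
  [set s | exists c, s = const_section c].

Lemma ext_space_sub : ext_space `<=` H0 ext_bundle.
Proof.
move=> s [c ->]; set v : 'cV[{poly F}]_(1 + m.+1) := col_mx 0 (map_mx polyC c).
have vE : map_mx (@chart0 F) v = ext_trans *m map_mx (@chart1 F) v.
  rewrite /ext_trans !map_col_mx mul_block_col !map_mx0 !mulmx0.
  by rewrite mul0mx !add0r mul1mx map_chartC.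
exact: vE.
Qed.

Lemma ext_space_dim : subspace_of_dim m.+1 ext_space.
Proof.
exists (fun i => const_section (delta_mx i 0)).
have sumE (a : 'I_m.+1 -> F) : \sum_i a i *: delta_mx i 0 = \col_i a i.
  by rewrite [RHS]matrix_sum_delta; apply: eq_bigr => i _; rewrite big_ord1 mxE.
split=> [a|].
  have -> : (0, 0) = const_section 0 by rewrite /const_section map_mx0 col_mx0.
  rewrite lin_comb_const_section sumE => /const_section_inj /colP a0 i.
  by have := a0 i; rewrite !mxE.
apply/seteqP; split=> [s [c ->]|s [a ->]].
  exists (fun i => c i 0); rewrite lin_comb_const_section sumE; congr const_section.
  by apply/colP => i; rewrite mxE.
by rewrite lin_comb_const_section; eexists.
Qed.

Definition ext_system : coherent_system F m.+2 d m.+1 :=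
  CoherentSystem ext_degree ext_space_sub ext_space_dim.

(** The monomials in [ext_class] represent independent classes in H^1(O(-d)): their
    exponents lie strictly between those that occur in functions regular at
    infinity and those that occur in t ^ d times a polynomial. *)
Lemma ext_class_independent (l : 'rV[F]_m.+1) (p0 p1 : {poly F}) : m.+2%:Z <= d ->
  chart0 p0 * t ^ d = (map_mx (@chart0 F) (map_mx polyC l) *m ext_class) 0 0 + chart1 p1 ->
  l = 0.
Proof.
move=> md E; have tn0 := tvar_neq0 F.
have [D dE] : exists D : nat, d = D%:Z by exists (absz d); lia.
pose N := size p1.
have : chart0 (p0 * 'X^(D + N)) =
    chart0 (\sum_i (l 0 i)%:P * 'X^(i.+1 + N) + reverse_poly N p1).
  rewrite rmorphD rmorphM /= -chart1_reverse // -/N.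
  rewrite exprD !rmorphM !rmorphXn /= chart0X mulrA -[t ^+ D]/(t ^ D%:Z) -dE E mulrDl.
  congr (_ + _); rewrite mxE mulr_suml rmorph_sum /=; apply: eq_bigr => i _.
  by rewrite !mxE !rmorphM !rmorphXn /= chart0X exprD mulrA.
move/chart0_inj => /polyP coefE; apply/rowP => i; rewrite mxE.
have := coefE (i.+1 + N)%N.
have iN : (i.+1 + N < N.+1)%N = false by lia.
have iD : (i.+1 < D)%N by have := ltn_ord i; lia.
rewrite coefMXn ltn_add2r iD coefD coef_sum coef_poly iN.
rewrite addr0 (bigD1 i) //= coefCM coefXn eqxx mulr1 big1 ?addr0 // => j ji.
by rewrite coefCM coefXn eqn_add2r eqSS (inj_eq val_inj) eq_sym (negPf ji) mulr0.
Qed.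

End Extension.

(** * Subsystems of the universal extension *)

Section Subsystems.
Variables (F : fieldType) (m : nat) (d : int).

Local Notation t := (tvar F).
Local Notation ev x := (fun p : {poly F} => p.[x]).
Local Notation c0 A := (map_mx (@chart0 F) A).
Local Notation c1 A := (map_mx (@chart1 F) A).
Local Notation E := (ext_bundle F m d).
Local Notation quot A := (usubmx (A : 'M_(1 + m.+1, _))).
Local Notation sub A := (dsubmx (A : 'M_(1 + m.+1, _))).

(** A left inverse of f(x), taken as a constant matrix, combines the rows of f
    into a square matrix whose determinant does not vanish at x. *)
Lemma fibre_minor n k (f : 'M[{poly F}]_(n, k)) x : \rank (map_mx (ev x) f) = k ->
  exists A : 'M[F]_(k, n), \det (map_mx polyC A *m f) != 0.
Proof.
move=> rk; exists (pinvmx (map_mx (ev x) f)).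
have Af : pinvmx (map_mx (ev x) f) *m map_mx (ev x) f = 1%:M.
  by apply: mulVpmx; rewrite /row_full rk.
apply: contra_eq_neq (det1 F k) => det0; rewrite -Af.
have -> : pinvmx (map_mx (ev x) f) *m map_mx (ev x) f =
    map_mx (horner_eval x) (map_mx polyC (pinvmx (map_mx (ev x) f)) *m f).
  rewrite map_mxM; congr (_ *m _).
  by apply/matrixP => i j; rewrite !mxE /= /horner_eval hornerC.
by rewrite det_map_mx det0 rmorph0 eq_sym oner_eq0.
Qed.

Lemma subbundle_inj n k (f : 'M[{poly F}]_(n, k)) x l (v : 'M_(k, l)) :
  \rank (map_mx (ev x) f) = k -> f *m v = 0 -> v = 0.
Proof.
move=> /fibre_minor [A detA] fv; set P := _ *m _ in detA.
have : \adj P *m P *m v = 0 by rewrite -mulmxA /P -mulmxA fv !mulmx0.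
rewrite mul_adj_mx mul_scalar_mx => /eqP.
by rewrite scalemx_eq0 (negPf detA) => /eqP.
Qed.

Lemma subbundle_comp n k l (E1 : vbundle F l) (E2 : vbundle F k) (E3 : vbundle F n)
    (g : bundle_hom E1 E2) (f : bundle_hom E2 E3) :
  subbundle g -> subbundle f ->
  exists2 h : bundle_hom E1 E3, subbundle h & hom0 h = hom0 f *m hom0 g.
Proof.
move=> subg subf.
have compat : c0 (hom0 f *m hom0 g) *m trans E1 = trans E3 *m c1 (hom1 f *m hom1 g).
  by rewrite !map_mxM /= -mulmxA hom_compat mulmxA hom_compat mulmxA.
exists (BundleHom compat) => //= x.
have rk (A : 'M[{poly F}]_(n, k)) (B : 'M[{poly F}]_(k, l)) :
    \rank (map_mx (ev x) A) = k -> \rank (map_mx (ev x) B) = l ->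
    \rank (map_mx (ev x) (A *m B)) = l.
  move=> rA rB; rewrite -[map_mx _ (_ *m _)]/(map_mx (horner_eval x) (A *m B)) map_mxM.
  apply: (rank_left_inverse (A := pinvmx (map_mx (ev x) B) *m pinvmx (map_mx (ev x) A))).
  rewrite mulmxA -[_ *m map_mx _ A]mulmxA mulVpmx ?mulmx1 ?mulVpmx //.
    by rewrite /row_full rB.
  by rewrite /row_full rA.
by split; apply: rk; have [? ?] := subf x; have [? ?] := subg x.
Qed.

Section Hom.
Variables (n : nat) (E' : vbundle F n) (f : bundle_hom E' E).

Lemma ext_hom_compat :
  c0 (quot (hom0 f)) *m trans E' = t ^ d *: c1 (quot (hom1 f)) /\
  c0 (sub (hom0 f)) *m trans E' = ext_class F m *m c1 (quot (hom1 f)) + c1 (sub (hom1 f)).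
Proof.
have fE : c0 (hom0 f : 'M_(1 + m.+1, n)) *m trans E' =
    ext_trans F m d *m c1 (hom1 f : 'M_(1 + m.+1, n)) := hom_compat f.
move: fE; rewrite -[hom0 f in X in X -> _](vsubmxK (hom0 f : 'M_(1 + m.+1, n))).
rewrite -[hom1 f in X in X -> _](vsubmxK (hom1 f : 'M_(1 + m.+1, n))).
rewrite !map_col_mx mul_col_mx /ext_trans mul_block_col mul0mx addr0 mul_scalar_mx mul1mx.
by move/eq_col_mx.
Qed.

Lemma quot_line_map : line_map E' d (quot (hom0 f), quot (hom1 f)).
Proof. by rewrite /line_map /=; have [] := ext_hom_compat. Qed.

(** The maximal minors of a subbundle of the trivial bundle are sections of the
    dual of its determinant, and some combination of them is nonzero. *)
Lemma trivial_part_degree d' : has_degree E' d' -> subbundle f ->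
  quot (hom0 f) = 0 -> d' <= 0.
Proof.
move=> [c cn0 detE'] subf q0; have [compatq compats] := ext_hom_compat.
have q1 : c1 (quot (hom1 f)) = 0.
  move/eqP: compatq; rewrite q0 map_mx0 mul0mx eq_sym scalemx_eq0 expfz_eq0.
  by rewrite (negPf (tvar_neq0 F)) andbF => /eqP.
have [A detA] := fibre_minor (f := hom0 f : 'M_(1 + m.+1, n)) (subf 0).1.
have AE (g : 'M[{poly F}]_(1 + m.+1, n)) : quot g = 0 ->
    map_mx polyC A *m g = map_mx polyC (rsubmx A) *m sub g.
  move=> g0; rewrite -{1}(vsubmxK g) -{1}[A]hsubmxK map_row_mx.
  by rewrite mul_row_col g0 mulmx0 add0r.
set B := rsubmx _ in AE; rewrite AE // in detA.
have glue : chart0 (\det (map_mx polyC B *m sub (hom0 f)) * c%:P) * t ^ d' =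
    chart1 (\det (map_mx polyC B *m sub (hom1 f))) * t ^ 0.
  rewrite rmorphM /= -mulrA -detE' -det_map_mx -det_mulmx map_mxM /= -mulmxA compats.
  by rewrite q1 mulmx0 add0r map_chartC -map_mxM /= det_map_mx expr0z mulr1.
have nz : \det (map_mx polyC B *m sub (hom0 f)) * c%:P != 0.
  by rewrite mulf_neq0 // polyC_eq0.
have := gluing_degree0 nz glue; move: nz; rewrite -size_poly_gt0.
by move: (size _) => z; lia.
Qed.

End Hom.

(** The kernel of E' -> O(d) lies in the trivial subbundle, so its degree, which
    is at least d' - d, is at most 0. *)
Lemma nontrivial_degree q (E' : vbundle F q.+1) (f : bundle_hom E' E) d' :
  has_degree E' d' -> subbundle f -> quot (hom0 f) != 0 ->
  d' <= d /\ (d' = d -> (exists z, quot (hom0 f) *m z = 1%:M) /\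
                        (exists z, quot (hom1 f) *m z = 1%:M)).
Proof.
move=> Ed' subf q0.
have [K [dK [g [[KdK le_dK] subg [killed _] _ surj]]]] :=
  kernel_subbundle Ed' (quot_line_map f) q0.
have [h subh hE] := subbundle_comp subg subf.
have := trivial_part_degree KdK subh; rewrite hE -mul_usub_mx killed => /(_ erefl) dK0.
split=> [|dE]; first by lia.
by apply: surj; lia.
Qed.

(** A complement [z] to the columns of [Z] makes a basis, so a functional
    vanishing on [Z] is determined by its value on [z]. *)
Lemma proportional q p (y : 'rV[{poly F}]_q.+1) (X : 'M_(p, q.+1)) z Z
    (C : 'M_(p, q)) C' (l : 'rV_p) :
  y *m z = 1%:M -> y *m Z = 0 -> X *m Z = C -> C' *m C = 1%:M -> l *m C = 0 ->
  l *m X = l *m X *m z *m y.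
Proof.
move=> yz yZ XZ C'C lC; pose M : 'M_(1 + q) := row_mx z Z.
have Mu : M \in unitmx.
  have : col_mx y (C' *m X) *m M = block_mx 1%:M 0 (C' *m X *m z) 1%:M.
    by rewrite mul_col_mx !mul_mx_row yz yZ -[C' *m X *m Z]mulmxA XZ C'C.
  move/(congr1 determinant); rewrite det_mulmx det_lblock !det1 mulr1 => detM.
  rewrite unitmxE; apply/unitrPr; exists (\det (col_mx y (C' *m X) : 'M_(1 + q))).
  by rewrite mulrC.
apply/eqP; rewrite -subr_eq0; apply/eqP.
rewrite -[LHS](mulmxK Mu) mul_mx_row !mulmxBl -!mulmxA yz yZ XZ lC !mulmx0 mulmx1.
by rewrite !subrr row_mx0 mul0mx.
Qed.

(** The sections Z are generically independent, and a nonzero functional y that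
    kills them leaves room for one fewer. *)
Lemma frame_rank n k (y : 'rV[{poly F}]_n) (X : 'M_(m.+1, n)) Z C (C' : 'M[F]_(k, m.+1)) :
  y *m Z = 0 -> X *m Z = map_mx polyC C -> C' *m C = 1%:M -> (k + (y != 0)%R <= n)%N.
Proof.
move=> yZ XZ C'C.
have rkZ : \rank (c0 Z) = k.
  apply: (rank_left_inverse (A := c0 (map_mx polyC C' *m X))).
  by rewrite -map_mxM /= -mulmxA XZ -map_mxM C'C !map_mx1.
have := mulmx0_rank_max (A := c0 y) (B := c0 Z).
rewrite -map_mxM yZ map_mx0 rkZ => /(_ erefl); rewrite addnC.
apply: leq_trans; rewrite leq_add2l; case: eqP => //= y0.
rewrite lt0n mxrank_eq0; apply/eqP => cy; apply: y0.
apply/matrixP => i j; have /matrixP/(_ i j) := cy; rewrite !mxE => /eqP.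
by rewrite chart0_eq0 => /eqP.
Qed.

Section Frame.
Variables (n k : nat) (d' : int) (S' : coherent_system F n d' k).
Variable f : bundle_hom (cs_bundle S') E.
Hypotheses (subf : subbundle f) (fV : hom_sections f @` cs_space S' `<=` @ext_space F m).

(** The constant sections in V' give independent vectors C of F^(n-1), because a
    subbundle is injective on sections. *)
Lemma subsystem_frame :
  exists (b : 'I_k -> local_sections F n) (C : 'M[F]_(m.+1, k)) (C' : 'M[F]_(k, m.+1)),
  [/\ C' *m C = 1%:M, forall j, cs_space S' (b j) &
      forall j, hom_sections f (b j) = const_section (col j C)].
Proof.
have [b [free VE bV]] := cs_basis S'.
have imb j : exists c, hom_sections f (b j) = const_section c.
  by apply: fV; exists (b j).
have [c cE] := fin_all_exists imb.
pose C : 'M[F]_(m.+1, k) := \matrix_(i, j) c j i 0.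
have colC j : col j C = c j by apply/colP => i; rewrite !mxE.
have Cfree : row_free C^T.
  rewrite -kermx_eq0; apply/rowV0P => a /sub_kermxP aC.
  have : hom_sections f (lin_comb (a 0) b) = const_section 0.
    rewrite hom_sections_lin_comb; under [in LHS]eq_fun do rewrite cE.
    rewrite lin_comb_const_section; congr const_section; apply/colP => i.
    have /rowP/(_ i) := aC; rewrite summxE !mxE => aCi; rewrite -[RHS]aCi.
    by apply: eq_bigr => j _; rewrite !mxE.
  rewrite /const_section map_mx0 col_mx0 => -[f0 f1].
  apply/rowP => j; rewrite mxE; apply: (free (a 0)).
  exact: congr2 (subbundle_inj (subf 0).1 f0) (subbundle_inj (subf 0).2 f1).
exists b, C, (pinvmx C^T)^T; split=> // [|j]; last by rewrite cE colC.
by apply: trmx_inj; rewrite trmx_mul trmxK mulmxVp // trmx1.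
Qed.

Lemma frame_matrix (b : 'I_k -> local_sections F n) (C : 'M[F]_(m.+1, k)) :
  (forall j, hom_sections f (b j) = const_section (col j C)) ->
  exists Z0 Z1 : 'M[{poly F}]_(n, k),
  [/\ quot (hom0 f) *m Z0 = 0, quot (hom1 f) *m Z1 = 0,
      sub (hom0 f) *m Z0 = map_mx polyC C & sub (hom1 f) *m Z1 = map_mx polyC C].
Proof.
move=> bC.
have fZ (g : 'M[{poly F}]_(1 + m.+1, n)) (s : 'I_k -> 'cV_n) :
    (forall j, g *m s j = col_mx (0 : 'M_1) (map_mx polyC (col j C))) ->
    usubmx g *m (\matrix_(i, j) s j i 0) = 0 /\
    dsubmx g *m (\matrix_(i, j) s j i 0) = map_mx polyC C.
  move=> gs; have gM : g *m (\matrix_(i, j) s j i 0) = col_mx 0 (map_mx polyC C).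
    apply/matrixP => i j; transitivity ((g *m s j) i 0).
      by rewrite !mxE; apply: eq_bigr => l _; rewrite mxE.
    rewrite gs -[i]splitK; case: (fintype.split i) => a /=.
      by rewrite !col_mxEu !mxE.
    by rewrite !col_mxEd !mxE.
  by rewrite mul_usub_mx mul_dsub_mx gM col_mxKu col_mxKd.
have [q0 s0] := fZ (hom0 f) (fun j => (b j).1) (fun j => congr1 fst (bC j)).
have [q1 s1] := fZ (hom1 f) (fun j => (b j).2) (fun j => congr1 snd (bC j)).
by exists (\matrix_(i, j) (b j).1 i 0), (\matrix_(i, j) (b j).2 i 0).
Qed.

End Frame.

(** In the extremal case, V' and a lift of a generator of O(d) form a basis of E'
    on each chart.  A nonzero constant functional l that kills V' is therefore a
    multiple of the quotient map on E', and comparing the two charts exhibits the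
    combination l of the extension classes as a coboundary. *)
Lemma extremal_subsystem q (E' : vbundle F q.+1) (f : bundle_hom E' E)
    Z0 Z1 (C : 'M[F]_(m.+1, q)) C' (z0 z1 : 'cV_q.+1) : m.+2%:Z <= d ->
  quot (hom0 f) *m Z0 = 0 -> quot (hom1 f) *m Z1 = 0 ->
  sub (hom0 f) *m Z0 = map_mx polyC C -> sub (hom1 f) *m Z1 = map_mx polyC C ->
  C' *m C = 1%:M -> quot (hom0 f) *m z0 = 1%:M -> quot (hom1 f) *m z1 = 1%:M ->
  (m.+1 <= q)%N.
Proof.
move=> md q0 q1 s0 s1 C'C qz0 qz1; rewrite leqNgt; apply/negP => lt_q.
have /rowV0Pn [l /sub_kermxP lC ln0] : kermx C != 0.
  rewrite kermx_eq0 /row_free neq_ltn; apply/orP; left.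
  exact: leq_ltn_trans (rank_leq_col _) _.
pose lp := map_mx polyC l.
have lpC : lp *m map_mx polyC C = 0 by rewrite -map_mxM lC map_mx0.
have C'Cp : map_mx polyC C' *m map_mx polyC C = 1%:M by rewrite -map_mxM C'C map_mx1.
have E0 := proportional qz0 q0 s0 C'Cp lpC.
have E1 := proportional qz1 q1 s1 C'Cp lpC.
set a0 := _ *m z0 in E0; set a1 := _ *m z1 in E1.
have [compatq compats] := ext_hom_compat f.
have key : (chart0 (a0 0 0) * t ^ d - ((c0 lp *m ext_class F m) 0 0 + chart1 (a1 0 0)))
    *: c1 (quot (hom1 f)) = 0.
  have := congr1 (mulmx (c0 lp)) compats.
  rewrite mulmxA -map_mxM /= E0 map_mxM /= -mulmxA compatq mulmxDr mulmxA.
  rewrite [c0 lp as X in _ = _ + X *m _]map_chartC -[c1 _ *m c1 (sub _)]map_mxM /= E1.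
  rewrite [a0]mx11_scalar [a1]mx11_scalar [_ *m ext_class F m]mx11_scalar.
  rewrite map_mxM !map_scalar_mx /= !mul_scalar_mx scalerA => keyE.
  by rewrite -!mx11_scalar scalerBl scalerDl keyE subrr.
have q1n0 : c1 (quot (hom1 f)) != 0.
  apply: contra_eq_neq qz1 => cq; rewrite eq_sym.
  have -> : quot (hom1 f) = 0.
    apply/matrixP => i j; have /matrixP/(_ i j) := cq; rewrite [LHS]mxE [RHS]mxE => /eqP.
    by rewrite chart1_eq0 [RHS]mxE => /eqP.
  by rewrite mul0mx; apply/eqP => /matrixP/(_ 0 0)/eqP; rewrite !mxE oner_eq0.
move/eqP: key; rewrite scalemx_eq0 (negPf q1n0) orbF subr_eq0.
move=> /eqP /(ext_class_independent md).
by move/eqP: ln0.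
Qed.

End Subsystems.

(** * Stability of the universal extension *)

(* The stability inequality with denominators cleared, for D the degree, M + 2 the
   rank of the system, and N, Q + 1, K the degree, rank and number of sections of
   a subsystem. *)
Section Slopes.
Variable R : realFieldType.
Implicit Types a D M Q N K : R.

Lemma slope_mono a M N N' K K' : 0 <= a -> 0 <= M -> N <= N' -> K <= K' ->
  (N + a * K) * (M + 1 + 1) <= (N' + a * K') * (M + 1 + 1).
Proof.
move=> a0 M0 NN KK; apply: ler_wpM2r; first lra.
by apply: lerD => //; apply: ler_wpM2l.
Qed.

Lemma slope_trivial a D M Q N K : a < D -> 0 <= a -> 0 <= M -> 0 <= Q ->
  N <= 0 -> K <= Q + 1 ->
  (N + a * K) * (M + 1 + 1) < (D + a * (M + 1)) * (Q + 1).
Proof.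
move=> ltA a0 M0 Q0 NN KK; apply: le_lt_trans (slope_mono a0 M0 NN KK) _.
have h : 0 < (D - a) * (Q + 1) by apply: mulr_gt0; lra.
nra.
Qed.

Lemma slope_small a D M Q N K : D - 1 <= a -> Q <= M + 1 -> M + 1 + 1 <= D ->
  0 <= M -> 0 <= Q -> N <= D -> K + 1 <= Q ->
  (N + a * K) * (M + 1 + 1) < (D + a * (M + 1)) * (Q + 1).
Proof.
move=> geA QM MD M0 Q0 NN KK; have {}KK : K <= Q - 1 by lra.
have a0 : 0 <= a by lra.
apply: le_lt_trans (slope_mono a0 M0 NN KK) _.
have h1 : 0 <= (a - (D - 1)) * (M + M + 3 - Q) by apply: mulr_ge0; lra.
have h2 : 0 <= (D - (M + 1 + 1)) * (M + 1 + 1) by apply: mulr_ge0; lra.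
have h3 := mulr_ge0 M0 M0; nra.
Qed.

Lemma slope_degree_drop a D M Q N K : D - 1 <= a -> Q <= M + 1 -> M + 1 + 1 <= D ->
  0 <= M -> 0 <= Q -> N <= D - 1 -> K <= Q ->
  (N + a * K) * (M + 1 + 1) < (D + a * (M + 1)) * (Q + 1).
Proof.
move=> geA QM MD M0 Q0 NN KK; have a0 : 0 <= a by lra.
apply: le_lt_trans (slope_mono a0 M0 NN KK) _.
have h1 : 0 <= (a - (D - 1)) * (M + 1 - Q) by apply: mulr_ge0; lra.
nra.
Qed.

End Slopes.

Section ExtStable.
Variables (F : fieldType) (m : nat) (d : int).
Hypothesis md : m.+2%:Z <= d.

Local Notation E := (ext_bundle F m d).
Local Notation quot A := (usubmx (A : 'M_(1 + m.+1, _))).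

Lemma extremal_unitmx (g : 'M[{poly F}]_(1 + m.+1)) (z : 'cV_m.+2)
    (Z : 'M_(m.+2, m.+1)) (C C' : 'M[F]_m.+1) :
  usubmx g *m z = 1%:M -> usubmx g *m Z = 0 -> dsubmx g *m Z = map_mx polyC C ->
  C' *m C = 1%:M -> g \in unitmx.
Proof.
move=> gz gZ sZ C'C; pose M : 'M_(1 + m.+1) := row_mx z Z.
have /(congr1 determinant) : g *m M = block_mx 1%:M 0 (dsubmx g *m z) (map_mx polyC C).
  by rewrite -{1}[g]vsubmxK mul_col_mx !mul_mx_row gz gZ sZ.
rewrite det_mulmx det_lblock det1 mul1r => detgM.
have : map_mx polyC C \in unitmx.
  by apply: (mulmx1_unit (A := map_mx polyC C') _).2; rewrite -map_mxM C'C map_mx1.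
by rewrite !unitmxE -detgM unitrM => /andP[].
Qed.

Lemma extremal_whole d' (S' : coherent_system F m.+2 d' m.+1)
    (f : bundle_hom (cs_bundle S') E) b (C C' : 'M[F]_m.+1) :
  hom_sections f @` cs_space S' `<=` @ext_space F m ->
  hom0 f \in unitmx -> hom1 f \in unitmx -> C' *m C = 1%:M ->
  (forall j, cs_space S' (b j)) ->
  (forall j, hom_sections f (b j) = const_section (col j C)) ->
  whole_system (S := ext_system F m d) f.
Proof.
move=> fV u0 u1 C'C bV bC; split.
  have compat : map_mx (@chart0 F) (invmx (hom0 f)) *m trans E =
      trans (cs_bundle S') *m map_mx (@chart1 F) (invmx (hom1 f)).
    have fE := hom_compat f.
    transitivity (map_mx (@chart0 F) (invmx (hom0 f)) *m
      (trans E *m map_mx (@chart1 F) (hom1 f)) *m map_mx (@chart1 F) (invmx (hom1 f))).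
      by rewrite -!mulmxA -map_mxM /= mulmxV // map_mx1 mulmx1.
    by rewrite -fE mulmxA -map_mxM /= mulVmx // map_mx1 mul1mx.
  by exists (BundleHom compat); split; rewrite /= ?mulmxV ?mulVmx.
apply/seteqP; split=> // s [c ->].
exists (lin_comb (fun j => (C' *m c) j 0) b); first exact: cs_space_lin_comb.
rewrite [LHS]hom_sections_lin_comb.
transitivity (lin_comb (fun j => (C' *m c) j 0) (fun j => const_section (col j C))).
  by congr lin_comb; apply: funext => j; apply: bC.
rewrite lin_comb_const_section; congr const_section.
transitivity (C *m (C' *m c)); last by rewrite mulmxA (mulmx1C C'C) mul1mx.
apply/colP => i; rewrite summxE [RHS]mxE; apply: eq_bigr => j _.
by rewrite mxE [col _ _ _ _]mxE mulrC.
Qed.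

(** The first alternative is that E' lies in the trivial subbundle; in the others
    E' maps nontrivially to O(d), and the last one is the extremal case. *)
Lemma subsystem_cases q d' k (S' : coherent_system F q.+1 d' k)
    (f : bundle_hom (cs_bundle S') E) :
  coherent_subsystem (S := ext_system F m d) f ->
  (q <= m.+1)%N /\
  [\/ d' <= 0 /\ (k <= q.+1)%N, d' <= d /\ (k < q)%N, d' <= d - 1 /\ (k <= q)%N |
      whole_system (S := ext_system F m d) f].
Proof.
move=> [_ subf fV]; split.
  by have := rank_leq_row (map_mx (fun p : {poly F} => p.[0]) (hom0 f)); rewrite (subf 0).1.
have [b [C [C' [C'C bV bC]]]] := subsystem_frame subf fV.
have [Z0 [Z1 [q0 q1 s0 s1]]] := frame_matrix bC.
have := frame_rank q0 s0 C'C; have [qf0|qf0] := eqVneq (quot (hom0 f)) 0.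
  rewrite addn0 => kq; constructor 1; split=> //.
  exact: trivial_part_degree (cs_degree S') subf qf0.
rewrite addn1 ltnS => kq; have [d'd surj] := nontrivial_degree (cs_degree S') subf qf0.
have [lt_kq|ge_kq] := ltnP k q; first by constructor 2.
have [d'E|d'n] := eqVneq d' d; last by constructor 3; split=> //; lia.
constructor 4; have [[z0 qz0] [z1 qz1]] := surj d'E.
have kE : k = q by lia.
subst k; have qm := extremal_subsystem md q0 q1 s0 s1 C'C qz0 qz1.
have qE : m.+1 = q.
  have := rank_leq_row (map_mx (fun p : {poly F} => p.[0]) (hom0 f)).
  by rewrite (subf 0).1; lia.
subst q; apply: (extremal_whole fV _ _ C'C bV bC).
  exact: extremal_unitmx qz0 q0 s0 C'C.
exact: extremal_unitmx qz1 q1 s1 C'C.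
Qed.

(** For n' < n, a subsystem with d' <= d - 1 and k' = n' - 1 satisfies the stability
    inequality once alpha > d - n / (n - n'), which alpha >= d - 1 ensures. *)
Lemma ext_stable (R : realType) (alpha : R) :
  d%:~R - 1 <= alpha -> alpha < d%:~R -> alpha_stable alpha (ext_system F m d).
Proof.
move=> ge_alpha lt_alpha n' d' k' S' f subS notwhole.
have n'0 : (0 < n')%N by case: subS.
case: n' S' f subS notwhole n'0 => // q S' f subS notwhole _.
have [qm cases] := subsystem_cases subS; rewrite mu_lt //.
have natR (x y : nat) : (x <= y)%N -> x%:R <= y%:R :> R by rewrite ler_nat.
have intR (x y : int) : x <= y -> x%:~R <= y%:~R :> R by rewrite ler_int.
have qmR := natR _ _ qm; have mdR := intR _ _ md.
have m0 : (0 : R) <= m%:R by []. have q0 : (0 : R) <= q%:R by [].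
rewrite -[(Posz m.+2)%:~R]/(m.+2%:R : R) in mdR.
rewrite -!natr1 in qmR mdR *.
move: cases => [[/intR d'R /natR kR]|[/intR d'R /natR kR]|[/intR d'R /natR kR]|//];
  rewrite -?natr1 ?rmorphB /= in d'R kR;
  move: (d%:~R : R) (d'%:~R : R) (m%:R : R) (q%:R : R) (k'%:R : R)
    ge_alpha lt_alpha qmR mdR m0 q0 d'R kR => D N M Q K geA ltA QM MD M0 Q0 ND KQ.
- by apply: slope_trivial; rewrite // (le_trans _ geA) //; lra.
- exact: slope_small.
exact: slope_degree_drop.
Qed.

End ExtStable.

Theorem proposition6p1 (F : closedFieldType) (R : realType)
  (n : nat) (d : int) (hn : (2 <= n)%N) :
  ((exists alpha : R, G F alpha n d n.-1 !=set0) <-> n%:Z <= d) /\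
  (n%:Z <= d ->
     has_sup [set alpha : R | G F alpha n d n.-1 !=set0] /\
     sup [set alpha : R | G F alpha n d n.-1 !=set0] = d%:~R).
Proof.
case: n hn => [|[|m]] // _.
have bounds (alpha : R) : G F alpha m.+2 d m.+1 !=set0 -> m.+2%:Z <= d /\ alpha < d%:~R.
  by case=> _ [S stS _]; apply: stable_bounds stS.
have stable (alpha : R) : m.+2%:Z <= d -> d%:~R - 1 <= alpha -> alpha < d%:~R ->
    G F alpha m.+2 d m.+1 !=set0.
  move=> md ge_alpha lt_alpha; eexists; exists (ext_system F m d); last by [].
  exact: ext_stable.
set A := [set alpha : R | _].
have A1 : m.+2%:Z <= d -> A (d%:~R - 1) by move=> md; apply: stable; rewrite // ltrBlDr ltrDl.
split; first split=> [[alpha /bounds []] //|/A1]; first by exists (d%:~R - 1).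
move=> md; have ubA : ubound A d%:~R by move=> alpha /bounds [_ /ltW].
have supA : has_sup A by split; [exists (d%:~R - 1); apply: A1 | exists d%:~R].
split=> //; apply/eqP; rewrite eq_le; apply/andP; split.
  by apply: ge_sup => //; exists (d%:~R - 1); apply: A1.
rewrite leNgt; apply/negP => lt_sup.
have ge_sup1 : d%:~R - 1 <= sup A by apply: ub_le_sup (A1 md); exists d%:~R.
have /stable Amid : m.+2%:Z <= d by [].
have : A ((sup A + d%:~R) / 2) by apply: Amid; lra.
by move=> /(ub_le_sup supA.2); lra.
Qed.
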